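(* Let $N\ge 1$, let $Q,B$ be real $N\times N$ matrices with $Q=Q^\star\ge 0$ such that $K(t)$ is invertible for every $t>0$, and assume $\operatorname{tr} B\ge 0$. Suppose that a measurable set $E\subset\mathbb R^N$ has finite $\sigma$-perimeter for some $\sigma\in(0,\frac12)$. Then $$\lim_{s\to0^+}s\,\mathfrak P_{\mathscr A,s}(E)=\begin{cases}2|E|,&\text{if }\operatorname{tr}B=0,\\[4pt] |E|,&\text{if }\operatorname{tr}B>0.\end{cases}$$
   Context: Here $Q,B$ are the constant coefficients of the operator $\mathscr A u=\operatorname{tr}(Q\nabla^2u)+\langle BX,\nabla u\rangle$ on $\mathbb R^N$, and $K(t)=\frac1t\int_0^t e^{sB}Qe^{sB^\star}\,ds$ for $t>0$ ($^\star$ denotes transpose). $|E|$ is Lebesgue measure, $\mathbf 1_E$ the indicator function of $E$, $L^p=L^p(\mathbb R^N)$. For $X,Y\in\mathbb R^N$, $t>0$, set $$p(X,Y,t)=\frac{(4\pi)^{-N/2}}{\sqrt{\det(tK(t))}}\exp\Big(-\frac{\langle K(t)^{-1}(Y-e^{tB}X),\,Y-e^{tB}X\rangle}{4t}\Big).$$ For $s>0$ and $1\le p<\infty$, $$\mathscr N^{\mathscr A}_{s,p}(f)=\Big(\int_0^\infty \frac{1}{t^{\frac{sp}{2}+1}}\int_{\mathbb R^N}\int_{\mathbb R^N}p(X,Y,t)|f(Y)-f(X)|^p\,dY\,dX\,dt\Big)^{1/p},$$ and $\mathfrak B^{\mathscr A}_{s,p}$ is the set of $f\in L^p$ with $\mathscr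 N^{\mathscr A}_{s,p}(f)<\infty$. A measurable set $E$ has finite $s$-perimeter if $\mathbf 1_E\in\mathfrak B^{\mathscr A}_{2s,1}$, and its $s$-perimeter is $\mathfrak P_{\mathscr A,s}(E)=\mathscr N^{\mathscr A}_{2s,1}(\mathbf 1_E)$. *)

(* Defs.v *)
From HB Require Import structures.
From mathcomp Require Import all_boot all_order all_algebra.
From mathcomp Require Import all_classical all_reals all_analysis.

Set Implicit Arguments.
Unset Strict Implicit.
Unset Printing Implicit Defensive.

Import Order.TTheory GRing.Theory Num.Theory.
Import numFieldNormedType.Exports.

Local Open Scope classical_set_scope.
Local Open Scope ring_scope.

Definition cV_display : measure_display -> measure_display.
Proof. exact. Qed.

(* The sigma-algebra generated by the coordinates, as the library does for
   n.-tuple T; on 'cV[R]_n, R a realType, it is the Borel sigma-algebra. *)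
Section measurable_cV.
Context {d} {T : measurableType d} {n : nat}.

Let coord : 'I_n -> 'cV[T]_n -> T := fun i v => v i ord0.

Let cV_set0 : g_sigma_preimage coord set0.
Proof. exact: sigma_algebra0. Qed.

Let cV_setC A : g_sigma_preimage coord A -> g_sigma_preimage coord (~` A).
Proof. exact: sigma_algebraC. Qed.

Let cV_bigcup (F : _^nat) : (forall i, g_sigma_preimage coord (F i)) ->
  g_sigma_preimage coord (\bigcup_i (F i)).
Proof. exact: sigma_algebra_bigcup. Qed.

HB.instance Definition _ := @isMeasurable.Build (cV_display d)
  'cV[T]_n (g_sigma_preimage coord) cV_set0 cV_setC cV_bigcup.

End measurable_cV.

Lemma measurable_coord d (T : measurableType d) n (i : 'I_n) :
  measurable_fun [set: 'cV[T]_n] (fun v : 'cV[T]_n => v i ord0).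
Proof.
move=> _ A mA; rewrite setTI; apply: sub_sigma_algebra.
rewrite -bigcup_seq /=; exists i => /=; first by rewrite mem_index_enum.
by exists A => //; rewrite setTI.
Qed.

Lemma measurable_fun_cV d1 d2 (T1 : measurableType d1) (T2 : measurableType d2)
    n (f : T1 -> 'cV[T2]_n) :
  (forall i, measurable_fun [set: T1] (fun x => f x i ord0)) ->
  measurable_fun [set: T1] f.
Proof.
move=> mf _; apply: smallest_sub => [|A].
  split => [|A mA|F mF].
  - by rewrite preimage_set0 setI0.
  - by rewrite setTI setTD preimage_setC; apply: measurableC;
      rewrite -[X in measurable X]setTI.
  - by rewrite preimage_bigcup setI_bigcupr; exact: bigcupT_measurable.
rewrite -bigcup_seq => -[i _ [C mC <-]].
by have := mf i measurableT C mC; rewrite !setTI.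
Qed.

Section lebesgue_cV.
Context {R : realType}.
Local Open Scope ereal_scope.

Definition cons_cV n (xv : measurableTypeR R * 'cV[R]_n) : 'cV[R]_(1 + n) :=
  col_mx (const_mx xv.1) xv.2.

Lemma measurable_cons_cV n : measurable_fun [set: _] (@cons_cV n).
Proof.
apply: measurable_fun_cV => i.
case: (split_ordP i) => k ->.
  by under eq_fun do rewrite col_mxEu mxE; exact: measurable_fst.
under eq_fun do rewrite col_mxEd.
apply: (measurableT_comp (measurable_coord k)); exact: measurable_snd.
Qed.

Lemma measurable_dsubmx n :
  measurable_fun [set: 'cV[R]_(1 + n)] (@dsubmx R 1 n 1).
Proof.
apply: measurable_fun_cV => i.
by under eq_fun do rewrite mxE; exact: measurable_coord.
Qed.

Section cons_measure.
Context {n : nat} (m : {sigma_finite_measure set 'cV[R]_n -> \bar R}).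

Definition cons_measure : set 'cV[R]_(1 + n) -> \bar R :=
  pushforward (@lebesgue_measure R \x m) (@cons_cV n).

Let mcons A : measurable A -> measurable (@cons_cV n @^-1` A).
Proof.
by move=> mA; rewrite -[X in measurable X]setTI; exact: measurable_cons_cV.
Qed.

Let cons_measure0 : cons_measure set0 = 0.
Proof. by rewrite /cons_measure /pushforward preimage_set0 measure0. Qed.

Let cons_measure_ge0 A : 0 <= cons_measure A.
Proof. exact: (measure_ge0 (@lebesgue_measure R \x m)). Qed.

Let cons_measure_sigma_additive : semi_sigma_additive cons_measure.
Proof.
move=> F mF tF mUF; rewrite /cons_measure /pushforward preimage_bigcup.
apply: measure_semi_sigma_additive.
- by move=> k; exact: mcons.
- apply/trivIsetP => /= i j _ _ ij; rewrite -preimage_setI.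
  by move/trivIsetP : tF => /(_ _ _ _ _ ij) ->//; rewrite preimage_set0.
- by rewrite -preimage_bigcup; exact: mcons.
Qed.

HB.instance Definition _ := isMeasure.Build _ _ _ cons_measure
  cons_measure0 cons_measure_ge0 cons_measure_sigma_additive.

Let cons_measure_sigma_finite : sigma_finite setT cons_measure.
Proof.
have /sigma_finiteP[F [TF ndF Foo]] := sigma_finiteT (@lebesgue_measure R).
have /sigma_finiteP[G [TG ndG Goo]] := sigma_finiteT m.
pose g (v : 'cV[R]_(1 + n)) := (v ord0 ord0, dsubmx v).
have mg : measurable_fun [set: _]
    (g : _ -> (measurableTypeR R * 'cV[R]_n)%type).
  apply/measurable_fun_pairP; split; last exact: measurable_dsubmx.
  exact: (@measurable_coord _ (measurableTypeR R) _ ord0).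
exists (fun k => g @^-1` (F k `*` G k)).
  apply/esym/seteqP; split => // v _.
  have [i _ Fi] : (\bigcup_i F i) (v ord0 ord0) by rewrite -TF.
  have [j _ Gj] : (\bigcup_j G j) (dsubmx v) by rewrite -TG.
  exists (maxn i j) => //; split => /=.
  - by move: Fi; exact/subsetPset/ndF/leq_maxl.
  - by move: Gj; exact/subsetPset/ndG/leq_maxr.
move=> k; have [mF Foo_] := Foo k; have [mG Goo_] := Goo k; split.
  by rewrite -[X in measurable X]setTI; apply: mg => //; exact: measurableX.
rewrite /cons_measure /pushforward -comp_preimage.
rewrite (_ : g \o _ = id) ?preimage_id.
  by rewrite product_measure1E// lte_mul_pinfty// ge0_fin_numE.
apply/funext => -[x v]; rewrite /g /cons_cV /= col_mxKd.
congr pair; transitivity (col_mx (const_mx x : 'cV[R]_1) v (lshift n ord0) ord0).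
  congr (col_mx _ _ _ _); exact/val_inj.
by rewrite col_mxEu mxE.
Qed.

HB.instance Definition _ := Measure_isSigmaFinite.Build _ _ _ cons_measure
  cons_measure_sigma_finite.

End cons_measure.

(* Lebesgue measure on the Borel sets of R^n, as an iterated product. *)
Fixpoint borel_lebesgue n : {sigma_finite_measure set 'cV[R]_n -> \bar R} :=
  match n with
  | 0 => @dirac _ 'cV[R]_0 0%R R
  | k.+1 => cons_measure (borel_lebesgue k)
  end.

Variable n : nat.

(* Lebesgue measurability is Caratheodory measurability for the outer measure
   induced by borel_lebesgue, and lebesgue_cV is the completed measure. *)
Definition lebesgue_measurable (E : set 'cV[R]_n) : Prop :=
  ((borel_lebesgue n)^*)%mu.-cara.-measurable E.

Definition lebesgue_cV := @completed_measure_extension _ _ _ (borel_lebesgue n).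

HB.instance Definition _ := Measure.on lebesgue_cV.

End lebesgue_cV.
Arguments lebesgue_cV {R n}.

Section matrix_exponential.
Context {R : realType} {n : nat}.

Definition expmx (A : 'M[R]_n) : 'M[R]_n :=
  limn (series (fun k => (k`!%:R)^-1 *: A ^+ k)).

Definition dotv (u v : 'cV[R]_n) : R := \sum_(i < n) u i ord0 * v i ord0.

End matrix_exponential.

Section fractional_perimeter.
Context {R : realType} {N : nat} (Q B : 'M[R]_N).

(* K(t); the integral of the matrix-valued function is taken entrywise. *)
Definition covmx (t : R) : 'M[R]_N :=
  t^-1 *: \matrix_(i, j) \int[lebesgue_measure]_(s in `[0, t])
    (expmx (s *: B) *m Q *m expmx (s *: B^T)) i j.

(* The transition density p(X,Y,t). *)
Definition heat_kernel (X Y : 'cV[R]_N) (t : R) : R :=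
  (4 * pi) `^ (- (N%:R / 2)) / Num.sqrt (\det (t *: covmx t)) *
  expR (- (dotv (invmx (covmx t) *m (Y - expmx (t *: B) *m X))
                (Y - expmx (t *: B) *m X) / (4 * t))).

Definition besov_seminorm (s p : R) (f : 'cV[R]_N -> R) : \bar R :=
  ((\int[lebesgue_measure]_(t in `]0%R, +oo[)
      (((t `^ (s * p / 2 + 1))^-1)%:E *
       \int[lebesgue_cV]_X \int[lebesgue_cV]_Y
         (heat_kernel X Y t * `|f Y - f X| `^ p)%:E)) `^ p^-1)%E.

Definition besov (s p : R) (f : 'cV[R]_N -> R) : Prop :=
  f \in Lfun lebesgue_cV p%:E /\ (besov_seminorm s p f < +oo)%E.

Definition perimeter (s : R) (E : set 'cV[R]_N) : \bar R :=
  besov_seminorm (2 * s) 1 \1_E.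

Definition finite_perimeter (s : R) (E : set 'cV[R]_N) : Prop :=
  besov (2 * s) 1 \1_E.

End fractional_perimeter.

(* Main.v *)
(* Let m = |E| and phi(t) be the double integral of p(X,Y,t) |1_E(Y) - 1_E(X)|.
   Since p integrates to 1 in Y and to det e^(-tB) = e^(-t tr B) in X, phi(t) is
   m (1 + e^(-t tr B)) minus twice the integral of p over E x E, which is at
   most m^2 sup p = O(m^2 / sqrt (det C(t))), C(t) = t K(t).  Now
   C(t+1) = C(1) + e^B C(t) e^(B^T), det e^B >= 1, and the determinant is
   superadditive on positive definite matrices (by induction on the size: the
   Schur complement is the minimum of the form over the first variable), so
   det C(t+1) >= det C(1) + det C(t).  Hence det C(t) grows at least linearly
   and phi(t) tends to m (1 + lim e^(-t tr B)).  The s-perimeter is the integral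
   of t^(-s-1) phi(t): its part over ]0, T] stays bounded as s -> 0 by finiteness
   at sigma, and s times the integral of t^(-s-1) over ]T, +oo[ is T^(-s) -> 1. *)
Require Import Defs.
From mathcomp Require Import all_boot all_order all_algebra.
From mathcomp Require Import all_classical all_reals all_analysis.
From mathcomp Require Import measurable_realfun perm ring lra.

Set Implicit Arguments.
Unset Strict Implicit.
Unset Printing Implicit Defensive.

Import Order.TTheory GRing.Theory Num.Theory.
Import numFieldNormedType.Exports.

Local Open Scope classical_set_scope.
Local Open Scope ring_scope.

(** Two measurability gaps shape the argument. The set $E$ is only Lebesgue measurable, while
    Tonelli's theorem is applied to the product of Borel measures; since $|E|$ is finite, $E$ is
    replaced by a Borel hull of the same measure, one integral at a time. Measurability of the
    exchange $\varphi$ in $t$ is never established: its integral is treated as a supremum over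
    simple functions below the integrand, and is split at $T$ only after passing to such a function.
    The Schur complement serves twice. As a minimum of the form it gives the comparison of
    determinants; through the completed square it evaluates Gaussian integrals one coordinate at a
    time, which avoids linear changes of variables in $\mathbb R^N$. The factor
    $e^{-t\operatorname{tr}B}$ then comes from the determinant of the kernel's quadratic form in
    $X$. *)

Definition qform (R : realType) n (S : 'M[R]_n) (v : 'cV[R]_n) : R :=
  dotv (S *m v) v.

Definition posdefmx (R : realType) n (S : 'M[R]_n) : Prop :=
  S^T = S /\ forall v, v != 0 -> 0 < qform S v.

(** * Positive definite forms, Schur complements and determinants *)

Section quadratic_forms.
Context {R : realType}.
Implicit Types n : nat.

Lemma dotvE n (u v : 'cV[R]_n) : dotv u v = (u^T *m v) ord0 ord0.
Proof. by rewrite /dotv !mxE; apply: eq_bigr => i _; rewrite mxE. Qed.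

Lemma dotvC n (u v : 'cV[R]_n) : dotv u v = dotv v u.
Proof. by apply: eq_bigr => i _; rewrite mulrC. Qed.

Lemma dotvDl n (u u' v : 'cV[R]_n) : dotv (u + u') v = dotv u v + dotv u' v.
Proof. by rewrite !dotvE raddfD mulmxDl mxE. Qed.

Lemma dotvDr n (u v v' : 'cV[R]_n) : dotv u (v + v') = dotv u v + dotv u v'.
Proof. by rewrite !dotvE mulmxDr mxE. Qed.

Lemma dotvZl n a (u v : 'cV[R]_n) : dotv (a *: u) v = a * dotv u v.
Proof. by rewrite !dotvE linearZ /= -scalemxAl mxE. Qed.

Lemma dotvZr n a (u v : 'cV[R]_n) : dotv u (a *: v) = a * dotv u v.
Proof. by rewrite dotvC dotvZl dotvC. Qed.

Lemma dotv_mull n m (A : 'M[R]_(n, m)) (u : 'cV[R]_m) (v : 'cV[R]_n) :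
  dotv (A *m u) v = dotv u (A^T *m v).
Proof. by rewrite !dotvE trmx_mul mulmxA. Qed.

Lemma dotv_gt0 n (v : 'cV[R]_n) : v != 0 -> 0 < dotv v v.
Proof.
move=> v0; rewrite lt_def; apply/andP; split; last first.
  by apply: sumr_ge0 => i _; rewrite -expr2 sqr_ge0.
apply: contra v0 => /eqP/psumr_eq0P v0; apply/eqP/matrixP => i j.
rewrite ord1 mxE; apply/eqP; rewrite -sqrf_eq0 expr2 v0 // => k _.
by rewrite -expr2 sqr_ge0.
Qed.

Lemma qformZ n a (S : 'M[R]_n) v : qform (a *: S) v = a * qform S v.
Proof. by rewrite /qform -scalemxAl dotvZl. Qed.

Lemma qformN n (S : 'M[R]_n) v : qform S (- v) = qform S v.
Proof. by rewrite -scaleN1r /qform -scalemxAr dotvZl dotvZr mulN1r mulN1r opprK. Qed.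

Lemma qform_sum n (S : 'M[R]_n) v :
  qform S v = \sum_i \sum_j v i ord0 * v j ord0 * S i j.
Proof.
rewrite /qform /dotv; apply: eq_bigr => i _; rewrite mxE mulr_suml.
by apply: eq_bigr => j _; ring.
Qed.

Lemma qform_congr n (A S : 'M[R]_n) v :
  qform (A *m S *m A^T) v = qform S (A^T *m v).
Proof. by rewrite /qform -!mulmxA dotv_mull !mulmxA. Qed.

Lemma qform_cV0 n (S : 'M[R]_n) : qform S 0 = 0.
Proof. by rewrite /qform mulmx0 dotvE mulmx0 mxE. Qed.

Lemma posdefmx_ge0 n (S : 'M[R]_n) v : posdefmx S -> 0 <= qform S v.
Proof.
case=> _ pS; have [->|/pS/ltW//] := eqVneq v 0.
by rewrite qform_cV0.
Qed.

Lemma posdefmxZ n a (S : 'M[R]_n) : 0 < a -> posdefmx S -> posdefmx (a *: S).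
Proof.
move=> a0 [sS pS]; split=> [|v v0]; first by rewrite linearZ /= sS.
by rewrite qformZ mulr_gt0 // pS.
Qed.

Lemma posdefmx_congr n (A S : 'M[R]_n) :
  A \in unitmx -> posdefmx S -> posdefmx (A *m S *m A^T).
Proof.
move=> uA [sS pS]; split=> [|v v0]; first by rewrite !trmx_mul trmxK sS mulmxA.
rewrite qform_congr pS //; apply: contra v0 => /eqP Av.
have uAT : A^T \in unitmx by rewrite unitmx_tr.
by rewrite -[v](mulKmx uAT) Av mulmx0.
Qed.

(** A zero of a nonnegative form is a minimum, so the gradient $2Sv$ vanishes there: if $w=Sv\ne0$,
    moving from $v$ along $-w$ would make the form negative. Invertibility then gives $v=0$. *)
Lemma unitmx_posdefmx n (S : 'M[R]_n) : S^T = S ->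
  (forall v, 0 <= qform S v) -> S \in unitmx -> posdefmx S.
Proof.
move=> sS pS uS; split=> // v v0; rewrite lt_def pS andbT.
apply: contra v0 => /eqP qv.
suff Sv0 : S *m v = 0 by rewrite -[v](mulKmx uS) Sv0 mulmx0.
apply/eqP; apply: contraT => /dotv_gt0.
set w := S *m v; set b := dotv w w; move=> b0.
have qw := pS w.
have E (l : R) : 0 <= l ^+ 2 * qform S w + 2 * l * b.
  have := pS (v + l *: w).
  rewrite /qform mulmxDr -scalemxAr !(dotvDl, dotvDr, dotvZl, dotvZr).
  rewrite -/(qform S v) qv -/(qform S w) (dotv_mull S w v) sS -/w -/b.
  by move=> h; apply: le_trans h _; rewrite le_eqVlt; apply/orP; left; apply/eqP; ring.
(* At this [l] the bound [E] reads $lb(1-l)\ge0$ although $l<0<b$. The extra [b] keeps the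
   denominator positive even if [qform S w] vanishes. *)
have := E (- b / (qform S w + b)).
have d0 : 0 < qform S w + b by rewrite ltr_wpDl.
set l := _ / _.
have lE : l * (qform S w + b) = - b by rewrite /l divfK // gt_eqF.
have l0 : l < 0 by rewrite /l mulNr oppr_lt0 divr_gt0.
move: qw; set q := qform S w in lE d0 *; move=> qw.
have -> : l ^+ 2 * q + 2 * l * b = l * (l * (q + b) + 2 * b - l * b) by ring.
rewrite lE nmulr_rge0 //; nra.
Qed.

Lemma posdefmx_unit n (S : 'M[R]_n) : posdefmx S -> S \in unitmx.
Proof.
move=> [sS pS]; rewrite -row_free_unit -kermx_eq0.
apply/eqP/row_matrixP => i; rewrite row0; apply/eqP; apply: contraT => h.
have /pS : (row i (kermx S))^T != 0 by rewrite trmx_eq0.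
rewrite /qform -{1}sS -trmx_mul.
by rewrite -row_mul mulmx_ker row0 trmx0 dotvE trmx0 mul0mx mxE ltxx.
Qed.

Lemma posdefmxV n (S : 'M[R]_n) : posdefmx S -> posdefmx (invmx S).
Proof.
move=> pS; have uS := posdefmx_unit pS; have sS := pS.1.
have -> : invmx S = invmx S *m S *m (invmx S)^T.
  by rewrite mulVmx // mul1mx trmx_inv sS.
by apply: posdefmx_congr; rewrite ?unitmx_inv.
Qed.

Definition schur n (S : 'M[R]_(1 + n)) : 'M[R]_n :=
  drsubmx S - (S ord0 ord0)^-1 *: (dlsubmx S *m ursubmx S).

Lemma ulsubmx_scalar n (S : 'M[R]_(1 + n)) : ulsubmx S = (S ord0 ord0)%:M.
Proof. by rewrite [ulsubmx S]mx11_scalar !mxE; congr (S _ _)%:M; exact/val_inj. Qed.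

(** One step of Gaussian elimination: a unit lower triangular factor clears the first column below
    the pivot. *)
Lemma det_schur n (S : 'M[R]_(1 + n)) : S ord0 ord0 != 0 ->
  \det S = S ord0 ord0 * \det (schur S).
Proof.
move=> a0; set a := S ord0 ord0.
have {1}-> : S = block_mx 1%:M 0 (a^-1 *: dlsubmx S) 1%:M *m
             block_mx a%:M (ursubmx S) 0 (schur S).
  rewrite mulmx_block !mul1mx !mul0mx !addr0.
  rewrite -scalemxAl mul_mx_scalar scalerA mulVf // scale1r.
  by rewrite -[LHS]submxK ulsubmx_scalar /schur -scalemxAl addrC subrK.
by rewrite det_mulmx det_lblock det_ublock !det1 !mul1r det_scalar1.
Qed.

(** Completing the square in the first coordinate. This identity gives both the minimality of the
    Schur complement and the reduction of Gaussian integrals by one dimension. *)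
Lemma qform_schur n (S : 'M[R]_(1 + n)) (x : 'cV[R]_1) v :
  S ord0 ord0 != 0 -> S^T = S ->
  qform S (col_mx x v) = S ord0 ord0 *
    (x ord0 ord0 + (S ord0 ord0)^-1 * (ursubmx S *m v) ord0 ord0) ^+ 2
    + qform (schur S) v.
Proof.
set a := S ord0 ord0 => a0 sS.
have dlE : dlsubmx S = (ursubmx S)^T by rewrite -[in RHS]sS trmx_ursub trmxK.
set b := ursubmx S.
rewrite /qform -{1}[S]submxK mul_block_col ulsubmx_scalar -/a -/b dlE -/b.
rewrite dotvE tr_col_mx mul_row_col mxE -!dotvE /schur mulmxBl !dotvDl dlE -/b.
have -> : dotv (- (a^-1 *: (b^T *m b) *m v)) v = - a^-1 * (b *m v) ord0 ord0 ^+ 2.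
  rewrite -scalemxAl -scaleNr dotvZl -mulmxA dotv_mull trmxK dotvE mxE big_ord1.
  by rewrite mxE expr2.
have -> : dotv (b^T *m x) v = x ord0 ord0 * (b *m v) ord0 ord0.
  by rewrite dotv_mull trmxK /dotv big_ord1.
have d1 (u w : 'cV[R]_1) : dotv u w = u ord0 ord0 * w ord0 ord0.
  by rewrite /dotv big_ord1.
rewrite !d1 mul_scalar_mx mxE.
set X := x _ _; set c := (b *m v) _ _; set d := dotv _ _; rewrite -/(qform _ _) -/d.
have -> : a * X * X + c * X + (X * c + d) = a * X ^+ 2 + 2 * X * c + d by ring.
by field.
Qed.

Lemma qform00 n (S : 'M[R]_n.+1) : qform S (delta_mx ord0 ord0) = S ord0 ord0.
Proof.
rewrite /qform dotvE -colE !mxE.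
rewrite (bigD1 ord0) //= !mxE eqxx mulr1 big1 ?addr0 //.
by move=> i i0; rewrite !mxE (negbTE i0) mulr0.
Qed.

Lemma posdefmx_00 n (S : 'M[R]_(1 + n)) : posdefmx S -> 0 < S ord0 ord0.
Proof.
case=> sS /(_ (delta_mx ord0 ord0)); rewrite (@qform00 n); apply.
by apply/negP => /eqP/matrixP/(_ ord0 ord0)/eqP; rewrite !mxE eqxx oner_eq0.
Qed.

Lemma posdefmx_schur n (S : 'M[R]_(1 + n)) : posdefmx S -> posdefmx (schur S).
Proof.
move=> pS; have /lt0r_neq0 a0 := posdefmx_00 pS; have [sS qS] := pS.
have dlE : dlsubmx S = (ursubmx S)^T by rewrite -[in RHS]sS trmx_ursub trmxK.
split=> [|v v0].
  by rewrite /schur dlE linearB /= linearZ /= trmx_mul trmxK trmx_drsub sS.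
(* With this [x] the square in [qform_schur] vanishes. *)
pose x : 'cV[R]_1 := - (S ord0 ord0)^-1 *: (ursubmx S *m v).
have /qS : col_mx x v != 0 by rewrite col_mx_eq0 negb_and v0 orbT.
rewrite qform_schur //; congr (_ < _).
by rewrite !mxE; ring.
Qed.

Lemma det_posdefmx_gt0 n (S : 'M[R]_n) : posdefmx S -> 0 < \det S.
Proof.
elim: n S => [S _|n IH S pS]; first by rewrite det_mx00.
have a0 := posdefmx_00 pS.
by rewrite det_schur ?gt_eqF// mulr_gt0 // IH //; exact: posdefmx_schur.
Qed.

Lemma qform_schur_min n (S : 'M[R]_(1 + n)) x v : posdefmx S ->
  qform (schur S) v <= qform S (col_mx x v).
Proof.
move=> pS; have a0 := posdefmx_00 pS.
by rewrite qform_schur ?gt_eqF ?pS.1 // lerDr mulr_ge0 ?sqr_ge0 // ltW.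
Qed.

Lemma qform_schur_attained n (S : 'M[R]_(1 + n)) v : posdefmx S ->
  exists x, qform (schur S) v = qform S (col_mx x v).
Proof.
move=> pS; have a0 := posdefmx_00 pS.
exists (- (S ord0 ord0)^-1 *: (ursubmx S *m v)).
by rewrite qform_schur ?gt_eqF ?pS.1 // !mxE; ring.
Qed.

(** At the minimiser for [T] the form of [S] is no larger, and its own minimum over the first
    variable is at most that value. *)
Lemma schur_le n (S T : 'M[R]_(1 + n)) : posdefmx S -> posdefmx T ->
  (forall v, qform S v <= qform T v) ->
  forall v, qform (schur S) v <= qform (schur T) v.
Proof.
move=> pS pT ST v; have [x ->] := qform_schur_attained v pT.
exact: le_trans (qform_schur_min x v pS) (ST _).
Qed.

(** Both factors of the pivot decomposition are monotone: the pivot is the form at the first basis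
    vector, and Schur complements inherit the order. *)
Lemma det_posdefmx_le n (S T : 'M[R]_n) : posdefmx S -> posdefmx T ->
  (forall v, qform S v <= qform T v) -> \det S <= \det T.
Proof.
elim: n S T => [S T|n IH S T pS pT ST]; first by rewrite !det_mx00.
have s0 := posdefmx_00 pS; have t0 := posdefmx_00 pT.
rewrite (@det_schur n S) ?gt_eqF// (@det_schur n T) ?gt_eqF//.
apply: ler_pM; first exact: ltW.
- by apply/ltW/det_posdefmx_gt0/posdefmx_schur.
- by have := ST (delta_mx ord0 ord0); rewrite !(@qform00 n).
- by apply: IH; [exact: posdefmx_schur..|exact: schur_le].
Qed.

(** Pivots are superadditive, and the Schur determinants of [S] and [T] are each at most that of
    [U], so the induction behind monotonicity is the only one. In size zero all determinants are 1
    and the inequality fails. *)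
Lemma det_posdefmx_superadd n (S T U : 'M[R]_n) : (0 < n)%N ->
  posdefmx S -> posdefmx T -> posdefmx U ->
  (forall v, qform S v + qform T v <= qform U v) -> \det S + \det T <= \det U.
Proof.
case: n S T U => // n S T U _ pS pT pU STU.
have s0 := posdefmx_00 pS; have t0 := posdefmx_00 pT; have u0 := posdefmx_00 pU.
have SU v : qform S v <= qform U v.
  by apply: le_trans (STU v); rewrite lerDl posdefmx_ge0.
have TU v : qform T v <= qform U v.
  by apply: le_trans (STU v); rewrite lerDr posdefmx_ge0.
rewrite (@det_schur n S) ?gt_eqF// (@det_schur n T) ?gt_eqF//.
rewrite (@det_schur n U) ?gt_eqF//.
have dS := det_posdefmx_le (posdefmx_schur pS) (posdefmx_schur pU) (schur_le pS pU SU).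
have dT := det_posdefmx_le (posdefmx_schur pT) (posdefmx_schur pU) (schur_le pT pU TU).
have dU := det_posdefmx_gt0 (posdefmx_schur pU).
apply: (@le_trans _ _ ((S ord0 ord0 + T ord0 ord0) * \det (schur U))).
  by rewrite mulrDl lerD // ler_pM2l.
rewrite ler_pM2r //; have := STU (delta_mx ord0 ord0).
by rewrite !(@qform00 n).
Qed.

End quadratic_forms.

(** * Derivatives of products and determinants *)

Section derivative_rules.
Context {R : realType}.

Lemma is_derive_bigsum (I : Type) (r : seq I) (h : I -> R -> R)
    (dh : I -> R) (x : R) : (forall i, is_derive x 1 (h i) (dh i)) ->
  is_derive x 1 (fun t => \sum_(i <- r) h i t) (\sum_(i <- r) dh i).
Proof.
move=> dhx; elim: r => [|i r IH].
  under eq_fun do rewrite big_nil.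
  by rewrite big_nil; exact: is_derive_cst.
under eq_fun do rewrite big_cons.
by rewrite big_cons; exact: is_deriveD.
Qed.

(** Uniqueness of the indices matters because the filter [j != i] must remove exactly one factor. *)
Lemma is_derive_bigprod (I : eqType) (r : seq I) (h : I -> R -> R)
    (dh : I -> R) (x : R) : uniq r -> (forall i, is_derive x 1 (h i) (dh i)) ->
  is_derive x 1 (fun t => \prod_(i <- r) h i t)
    (\sum_(i <- r) dh i * \prod_(j <- r | j != i) h j x).
Proof.
move=> + dhx; elim: r => [_|i r IH /= /andP[ir ur]].
  under eq_fun do rewrite big_nil.
  by rewrite big_nil; exact: is_derive_cst.
under eq_fun do rewrite big_cons.
rewrite big_cons big_cons eqxx /=.
apply: (is_derive_eq (is_deriveM (dhx i) (IH ur))).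
rewrite /GRing.scale /= addrC; congr (_ + _).
  rewrite mulrC; congr (_ * _); rewrite big_seq_cond [RHS]big_seq_cond.
  apply: eq_bigl => j; rewrite andbT.
  by have [->|] := eqVneq j i; rewrite ?(negbTE ir) ?andbT.
rewrite mulr_sumr; apply: eq_big_seq => j jr.
rewrite big_cons; have [ij|_] := eqVneq i j; first by rewrite ij jr in ir.
by rewrite mulrCA.
Qed.

Lemma is_derive_mulmx n m p (F : R -> 'M[R]_(n, m)) (G : R -> 'M[R]_(m, p))
    (F' : 'M[R]_(n, m)) (G' : 'M[R]_(m, p)) (x : R) :
  (forall i j, is_derive x 1 (fun t => F t i j) (F' i j)) ->
  (forall i j, is_derive x 1 (fun t => G t i j) (G' i j)) ->
  forall i j, is_derive x 1 (fun t => (F t *m G t) i j)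
    ((F' *m G x + F x *m G') i j : R).
Proof.
move=> dF dG i j.
under eq_fun do rewrite mxE.
rewrite !mxE -big_split /=; apply: is_derive_bigsum => k.
have -> : F' i k * G x k j + F x i k * G' k j =
    F x i k *: G' k j + G x k j *: F' i k by rewrite addrC [X in _ + X]mulrC.
exact: is_deriveM.
Qed.

(** The new matrix is [F] multiplied on the left by the identity with row [i] replaced by that of
    [B]; expanded along column [i], that factor has determinant [B i i]. *)
Lemma det_row_mul n (B F : 'M[R]_n) i :
  \det (\matrix_(j, k) (if j == i then (B *m F) j k else F j k)) = B i i * \det F.
Proof.
pose T := \matrix_(j, k) (if j == i then B j k else (j == k)%:R).
have -> : \matrix_(j, k) (if j == i then (B *m F) j k else F j k) = T *m F.
  apply/matrixP => j k; rewrite !mxE; have [->|ji] := eqVneq j i.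
    by apply: eq_bigr => l _; rewrite mxE eqxx.
  rewrite (bigD1 j) //= mxE (negbTE ji) eqxx mul1r big1 ?addr0 // => l lj.
  by rewrite mxE (negbTE ji) eq_sym (negbTE lj) mul0r.
rewrite det_mulmx; congr (_ * _).
rewrite (expand_det_col T i) (bigD1 i) //= mxE eqxx big1 => [|j ji]; last first.
  by rewrite mxE (negbTE ji) mul0r.
rewrite addr0 /cofactor (_ : row' i (col' i T) = 1%:M).
  by rewrite det1 -signr_odd oddD addbb expr0 mulr1 mulr1.
apply/matrixP => j k; rewrite !mxE eq_sym (negbTE (neq_lift i j)).
by rewrite (inj_eq lift_inj).
Qed.

(** Jacobi's formula along $F'=BF$: the Leibniz expansion is differentiated one row at a time, and
    summing [det_row_mul] over the rows produces the trace. *)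
Lemma is_derive_det n (F : R -> 'M[R]_n) (B : 'M[R]_n) (x : R) :
  (forall i j, is_derive x 1 (fun t => F t i j) ((B *m F x) i j : R)) ->
  is_derive x 1 (fun t => \det (F t)) (\tr B * \det (F x)).
Proof.
move=> dF.
pose D (i : 'I_n) (s : {perm 'I_n}) :=
  (B *m F x) i (s i) * \prod_(j | j != i) F x j (s j).
have -> : \tr B * \det (F x) = \sum_(s : {perm 'I_n}) (-1) ^+ s * \sum_i D i s.
  under [RHS]eq_bigr do rewrite mulr_sumr.
  rewrite exchange_big /= /mxtrace mulr_suml; apply: eq_bigr => i _.
  rewrite -det_row_mul; apply: eq_bigr => s _; congr (_ * _).
  rewrite (bigD1 i) //= mxE eqxx; congr (_ * _).
  by apply: eq_bigr => j ji; rewrite mxE (negbTE ji).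
apply: is_derive_bigsum => s.
have H : is_derive x 1 (fun t => \prod_i F t i (s i)) (\sum_i D i s).
  by apply: is_derive_bigprod => //; exact: index_enum_uniq.
exact: is_deriveZ.
Qed.

Lemma derive0_eq_mx n m (F : R -> 'M[R]_(n, m)) :
  (forall (x : R) i j, is_derive x 1 (fun t => F t i j) 0) -> forall x y, F x = F y.
Proof.
move=> dF x y; apply/matrixP => i j.
by apply: (@is_derive_0_is_cst _ (fun t => F t i j)).
Qed.

End derivative_rules.

(** * Power series dominated by an exponential series *)

Section exponential_coefficients.
Context {R : realType}.
Implicit Types (c : R^nat) (M b : R).

(** This bound is stable under formal differentiation, with [M * b] in place of [M]; termwise
    differentiation asks for convergence of the series and of its first two derived series. *)
Definition exp_dominated M b c := forall k, `|c k| <= M * (b ^+ k / k`!%:R).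

Lemma exp_dominated_diffs M b c : exp_dominated M b c ->
  exp_dominated (M * b) b (pseries_diffs c).
Proof.
move=> cM k; rewrite /pseries_diffs normrM normr_nat.
apply: le_trans (ler_wpM2l _ (cM k.+1)) _ => //.
rewrite factS natrM invfM exprS le_eqVlt; apply/orP; left; apply/eqP.
by field; rewrite nat1r !pnatr_eq0 -lt0n fact_gt0.
Qed.

Lemma is_cvg_pseries_exp_dominated M b c (x : R) : exp_dominated M b c ->
  cvgn (pseries c x).
Proof.
move=> cM; apply: normed_cvg.
have M0 : 0 <= M by have := cM 0%N; rewrite expr0 fact0 divr1 mulr1; exact: le_trans.
apply: (@series_le_cvg _ _ (fun k => M * exp_coeff (`|b| * `|x|) k)) => [|k|k|].
- by move=> k; exact: normr_ge0.
- by rewrite mulr_ge0 // exp_coeff_ge0 // mulr_ge0.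
- rewrite /= normrM normrX /exp_coeff /= exprMn.
  apply: le_trans (ler_wpM2r _ (cM k)) _; first exact: exprn_ge0.
  rewrite -mulrA ler_wpM2l // [leLHS]mulrAC ler_wpM2r // ?invr_ge0 //.
  by rewrite ler_wpM2r ?exprn_ge0 // -normrX ler_norm.
- exact: (is_cvg_seriesZ (k := M) (is_cvg_series_exp_coeff (`|b| * `|x|))).
Qed.

Lemma is_derive_pseries_exp_dominated M b c (x : R) : exp_dominated M b c ->
  is_derive x 1 (fun t => limn (pseries c t)) (limn (pseries (pseries_diffs c) x)).
Proof.
move=> cM; have dcM := exp_dominated_diffs cM.
apply: (@pseries_snd_diffs _ _ (`|x| + 1)).
- exact: is_cvg_pseries_exp_dominated cM.
- exact: is_cvg_pseries_exp_dominated dcM.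
- exact: is_cvg_pseries_exp_dominated (exp_dominated_diffs dcM).
- by rewrite [ltRHS]ger0_norm ?addr_ge0 // ltrDl.
Qed.

End exponential_coefficients.

(** * The matrix exponential: derivative, group law and determinant *)

Section matrix_exponential_theory.
Context {R : realType} {n : nat}.
Implicit Types (A B : 'M[R]_n) (s t : R).

Definition expmx_coef B i j : R^nat := fun k => (k`!%:R)^-1 * (B ^+ k) i j.

(** The sum of the absolute values of all entries dominates every row sum, so by induction its
    [k]-th power dominates every entry of $B^k$. *)
Lemma expmx_coef_dominated B i j :
  exp_dominated 1 (\sum_k \sum_l `|B k l|) (expmx_coef B i j).
Proof.
move=> k; rewrite /expmx_coef normrM mul1r [leLHS]mulrC (ger0_norm (x := _^-1)) ?invr_ge0 //.
rewrite ler_wpM2r ?invr_ge0 //.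
elim: k i j => [|k IH] i j.
  by rewrite !expr0 mxE; case: (_ == _); rewrite ?normr1 ?normr0.
rewrite !exprS mxE; apply: le_trans (ler_norm_sum _ _ _) _.
apply: (@le_trans _ _ (\sum_l `|B i l| * (\sum_k \sum_l `|B k l|) ^+ k)).
  by apply: ler_sum => l _; rewrite normrM ler_wpM2l.
rewrite -mulr_suml ler_wpM2r //.
  by rewrite exprn_ge0 //; apply: sumr_ge0 => ? _; exact: sumr_ge0.
rewrite [leRHS](bigD1 i) //= lerDl; apply: sumr_ge0 => ? _; exact: sumr_ge0.
Qed.

Lemma exprZmx s B k : (s *: B) ^+ k = s ^+ k *: B ^+ k.
Proof.
elim: k => [|k IH]; first by rewrite !expr0 scale1r.
rewrite !exprS IH -[LHS]/((s *: B) *m (s ^+ k *: B ^+ k)).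
by rewrite -scalemxAl -scalemxAr scalerA.
Qed.

(** The limit defining [expmx] is taken in the maximum norm, and finitely many entries converge
    simultaneously. *)
Lemma expmxE B s i j : expmx (s *: B) i j = limn (pseries (expmx_coef B i j) s).
Proof.
pose L := \matrix_(i, j) limn (pseries (expmx_coef B i j) s).
suff -> : expmx (s *: B) = L by rewrite mxE.
apply/cvg_lim => //; apply/cvgrPdist_le => /= e e0; near=> m.
rewrite /Num.Def.normr/= mx_normrE (bigmax_le _ (ltW e0))//= => kl _.
move: kl; near: m; apply: filter_forall => -[k l] /=.
have := is_cvg_pseries_exp_dominated (x := s) (@expmx_coef_dominated B k l).
move/cvgrPdist_le => /(_ _ e0); apply: filterS => m.
rewrite !mxE /series /= summxE; congr (`|_ - _| <= _).
apply: eq_bigr => q _; rewrite exprZmx !mxE /expmx_coef /=.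
by rewrite mulrAC -mulrA.
Unshelve. all: by end_near. Qed.

Lemma cvg_pseries_expmx B s i j :
  pseries (expmx_coef B i j) s @ \oo --> expmx (s *: B) i j.
Proof.
rewrite expmxE.
exact: is_cvg_pseries_exp_dominated (@expmx_coef_dominated B i j).
Qed.

Lemma pseries_expmx_mull B s i j :
  limn (pseries (pseries_diffs (expmx_coef B i j)) s) = (B *m expmx (s *: B)) i j.
Proof.
apply/cvg_lim => //; rewrite mxE.
rewrite (_ : pseries _ s =
    fun m => \sum_k B i k * pseries (expmx_coef B k j) s m).
  apply: cvg_big => [|k _]; first exact: add_continuous.
  by apply: cvgZr; exact: cvg_pseries_expmx.
apply/funext => m; rewrite /pseries /series /=.
under [RHS]eq_bigr do rewrite mulr_sumr.
rewrite exchange_big /=; apply: eq_bigr => q _.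
rewrite /pseries_diffs /expmx_coef exprS mxE !mulr_sumr mulr_suml.
apply: eq_bigr => k _; rewrite factS natrM.
by field; rewrite nat1r !pnatr_eq0 -lt0n fact_gt0.
Qed.

Lemma pseries_expmx_mulr B s i j :
  limn (pseries (pseries_diffs (expmx_coef B i j)) s) = (expmx (s *: B) *m B) i j.
Proof.
apply/cvg_lim => //; rewrite mxE.
rewrite (_ : pseries _ s =
    fun m => \sum_k B k j * pseries (expmx_coef B i k) s m).
  under eq_bigr do rewrite mulrC.
  apply: cvg_big => [|k _]; first exact: add_continuous.
  by apply: cvgZr; exact: cvg_pseries_expmx.
apply/funext => m; rewrite /pseries /series /=.
under [RHS]eq_bigr do rewrite mulr_sumr.
rewrite exchange_big /=; apply: eq_bigr => q _.
rewrite /pseries_diffs /expmx_coef exprSr mxE !mulr_sumr mulr_suml.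
apply: eq_bigr => k _; rewrite factS natrM.
by field; rewrite nat1r !pnatr_eq0 -lt0n fact_gt0.
Qed.

Lemma is_derive_expmx B s i j :
  is_derive s 1 (fun t => expmx (t *: B) i j) ((B *m expmx (s *: B)) i j : R).
Proof.
rewrite -pseries_expmx_mull; under eq_fun do rewrite expmxE.
exact: is_derive_pseries_exp_dominated (@expmx_coef_dominated B i j).
Qed.

(** Both products are the same derived series, read with $B^{k+1}=BB^k$ or $B^{k+1}=B^kB$. *)
Lemma expmx_comm B s : B *m expmx (s *: B) = expmx (s *: B) *m B.
Proof.
by apply/matrixP => i j; rewrite -pseries_expmx_mull -pseries_expmx_mulr.
Qed.

Lemma expmx0 B : expmx (0 *: B) = 1%:M.
Proof.
apply/matrixP => i j; rewrite expmxE; apply/cvg_lim => //.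
apply: cvg_near_cst; near=> m; rewrite /pseries /series /=.
have -> : m = m.-1.+1 by rewrite prednK //; near: m; exact: nbhs_infty_gt.
rewrite big_nat_recl // /expmx_coef !expr0 fact0 invr1 mul1r mulr1 big1 ?addr0 //.
by move=> k _; rewrite expr0n mulr0.
Unshelve. all: by end_near. Qed.

Lemma expmx_tr B s : (expmx (s *: B))^T = expmx (s *: B^T).
Proof.
apply/matrixP => i j; rewrite mxE !expmxE; congr (limn (pseries _ s)).
apply/funext => k; rewrite /expmx_coef; congr (_ * _).
have -> : B^T ^+ k = (B ^+ k)^T; last by rewrite mxE.
elim: k => [|k IH]; first by rewrite !expr0 trmx1.
by rewrite exprS exprSr IH [RHS]trmx_mul.
Qed.

Lemma is_derive_expmxN B s i j :
  is_derive s 1 (fun t => expmx (- t *: B) i j) ((- B *m expmx (- s *: B)) i j : R).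
Proof.
have E t : - t *: B = t *: (- B) by rewrite scalerN scaleNr.
by under eq_fun do rewrite E; rewrite E; exact: is_derive_expmx.
Qed.

Lemma is_derive_expmx_shift B s u i j :
  is_derive s 1 (fun t => expmx ((t + u) *: B) i j) ((B *m expmx ((s + u) *: B)) i j : R).
Proof.
have H := is_derive_expmx B (s + u) i j.
have K : is_derive s 1 (fun t => t + u) (1 : R).
  by apply: (is_derive_eq (is_deriveD _ _)); rewrite addr0.
have := @is_derive1_comp _ (fun t => expmx (t *: B) i j) (fun t => t + u) s _ _ H K.
by rewrite mulr1.
Qed.

(** As a function of [s] the left side has zero derivative, because $B$ commutes with its
    exponential, and at 0 it is $e^{uB}$. The case $u=0$ gives the inverse, and with it the addition
    law follows. *)
Lemma expmxNK B s u : expmx (- s *: B) *m expmx ((s + u) *: B) = expmx (u *: B).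
Proof.
pose F t := expmx (- t *: B) *m expmx ((t + u) *: B).
rewrite -[LHS]/(F s) (@derive0_eq_mx _ _ _ F _ s 0); last first.
  move=> x i j.
  have E : - B *m expmx (- x *: B) *m expmx ((x + u) *: B) +
      expmx (- x *: B) *m (B *m expmx ((x + u) *: B)) = 0 :> 'M[R]_n.
    by rewrite mulmxA -[_ *m B](expmx_comm B (- x)) !mulNmx addNr.
  apply: (is_derive_eq (is_derive_mulmx
    (is_derive_expmxN B x) (is_derive_expmx_shift B x u) i j)).
  by have /matrixP/(_ i j) := E; rewrite [in RHS]mxE.
by rewrite /F oppr0 expmx0 mul1mx add0r.
Qed.

Lemma expmxN B s : expmx (- s *: B) *m expmx (s *: B) = 1%:M.
Proof. by have := expmxNK B s 0; rewrite addr0 expmx0. Qed.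

Lemma expmxD B s t : expmx ((s + t) *: B) = expmx (s *: B) *m expmx (t *: B).
Proof.
rewrite -(expmxNK B s t) mulmxA.
by have := expmxN B (- s); rewrite opprK => ->; rewrite mul1mx.
Qed.

(** Liouville's formula: $e^{-t\operatorname{tr}B}\det e^{tB}$ has zero derivative by
    [is_derive_det] and equals 1 at 0. *)
Lemma det_expmx B s : \det (expmx (s *: B)) = expR (s * \tr B).
Proof.
pose g t := \det (expmx (t *: B)) * expR (- t * \tr B).
have dg (x : R) : is_derive x 1 g 0.
  have dd := is_derive_det (is_derive_expmx B x).
  have de : is_derive x 1 (fun t => expR (- t * \tr B))
      (expR (- x * \tr B) * (- \tr B)).
    have dl : is_derive x 1 (fun t : R => - t * \tr B) (- \tr B).
      have -> : (fun t : R => - t * \tr B) = (- \tr B) \*: id.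
        by apply/funext => t; rewrite /= mulNr mulrC -mulNr.
      apply: (is_derive_eq (is_deriveZ _ _)).
      by rewrite /GRing.scale /= mulr1.
    exact: is_derive1_comp (is_derive_expR _) dl.
  apply: (is_derive_eq (is_deriveM dd de)).
  by rewrite /GRing.scale /=; ring.
have := is_derive_0_is_cst s 0 dg.
rewrite /g oppr0 mul0r expR0 expmx0 det1 mulr1 mulNr expRN => gs.
by move/divr1_eq: gs.
Qed.

End matrix_exponential_theory.

(** * Integrals of continuous functions: finite sums, shift and splitting *)

Section continuous_integrals.
Context {R : realType}.
Local Notation mu := (@lebesgue_measure R).

Lemma continuous_integrable_itv (f : R -> R) (a b : R) : continuous f ->
  mu.-integrable `[a, b] (EFin \o f).
Proof.
move=> cf; apply: continuous_compact_integrable; first exact: segment_compact.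
exact: continuous_subspaceT.
Qed.

Lemma Rintegral_sum_continuous (I : Type) (r : seq I) (f : I -> R -> R) (a b : R) :
  (forall i, continuous (f i)) ->
  \int[mu]_(x in `[a, b]) (\sum_(i <- r) f i x) =
  \sum_(i <- r) \int[mu]_(x in `[a, b]) f i x.
Proof.
move=> cf; elim: r => [|i r IH].
  under eq_Rintegral do rewrite big_nil.
  by rewrite big_nil Rintegral_cst // mul0r.
under eq_Rintegral do rewrite big_cons.
rewrite big_cons -IH RintegralD //; apply: continuous_integrable_itv => //.
by move=> x; apply: cvg_big => [|j _]; [exact: add_continuous|exact: cf].
Qed.

Lemma Rintegral_shift1 (f : R -> R) (t : R) : 0 <= t -> continuous f ->
  \int[mu]_(x in `[1, t + 1]) f x = \int[mu]_(x in `[0, t]) f (x + 1).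
Proof.
move=> t0 cf; rewrite /Rintegral; congr fine.
have dF : derive1 (fun x : R => x + 1) = cst 1.
  by apply/funext => x; rewrite derive1E derive_val addr0.
have := @integration_by_substitution_increasing R (fun x => x + 1) f 0 t t0.
rewrite add0r => -> //.
- by apply: eq_integral => x _ /=; rewrite fctE dF /= mulr1.
- by move=> x y _ _ xy; rewrite ltrD2r.
- by rewrite dF => x _; exact: cst_continuous.
- by rewrite dF; exact: is_cvg_cst.
- by rewrite dF; exact: is_cvg_cst.
- split => /=.
  + by move=> x _; exact: derivableD.
  + by apply: cvg_at_right_filter; apply: cvgD => //; exact: cvg_cst.
  + by apply: cvg_at_left_filter; apply: cvgD => //; exact: cvg_cst.
- exact: continuous_subspaceT.
Qed.

Lemma Rintegral_split1 (f : R -> R) (t : R) : 0 <= t -> continuous f ->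
  \int[mu]_(x in `[0, t + 1]) f x =
  \int[mu]_(x in `[0, 1]) f x + \int[mu]_(x in `[0, t]) f (x + 1).
Proof.
move=> t0 cf; rewrite -Rintegral_shift1 //.
have i0 := @continuous_integrable_itv f 0 (t + 1) cf.
have i1 := @continuous_integrable_itv f 1 (t + 1) cf.
rewrite -(Rintegral_itv_obnd_cbnd (r := 1)); last first.
  by apply: integrableS i1 => //; apply: subset_itvr; rewrite bnd_simp.
rewrite -(Rintegral_itvB (x := 1) i0) ?bnd_simp //.
- by rewrite [RHS]addrC subrK.
- by rewrite lerDr.
Qed.

End continuous_integrals.

(** * The covariance $C(t)$ and the growth of its determinant *)

Section integrated_covariance.
Context {R : realType} {n : nat} (Q B : 'M[R]_n).
Hypothesis Qsym : Q^T = Q.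
Hypothesis Qge0 : forall v : 'cV[R]_n, 0 <= dotv (Q *m v) v.
Local Notation mu := (@lebesgue_measure R).

Definition cov_density (s : R) : 'M[R]_n :=
  expmx (s *: B) *m Q *m (expmx (s *: B))^T.

(** The matrix $C(t)$ of the overview: for $t>0$ the factor undoes the averaging in [covmx]. *)
Definition tcovmx (t : R) : 'M[R]_n := t *: covmx Q B t.

Lemma tcovmxE t : 0 < t -> tcovmx t =
  \matrix_(i, j) \int[mu]_(s in `[0, t]) cov_density s i j.
Proof.
move=> t0; rewrite /tcovmx /covmx scalerA divff ?gt_eqF // scale1r.
apply/matrixP => i j; rewrite !mxE; apply: eq_Rintegral => s _.
by rewrite /cov_density expmx_tr.
Qed.

Lemma continuous_mulmx_entries m p q (F : R -> 'M[R]_(m, p)) (G : R -> 'M[R]_(p, q)) :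
  (forall i j, continuous (fun s => F s i j)) ->
  (forall i j, continuous (fun s => G s i j)) ->
  forall i j, continuous (fun s => (F s *m G s) i j).
Proof.
move=> cF cG i j s; under eq_fun do rewrite mxE.
apply: cvg_big => [|k _]; first exact: add_continuous.
by apply: cvgM; [exact: cF|exact: cG].
Qed.

Lemma continuous_expmx i j : continuous (fun s : R => expmx (s *: B) i j).
Proof.
move=> s; apply/differentiable_continuous/derivable1_diffP.
by case: (is_derive_expmx B s i j).
Qed.

Lemma continuous_cov_density i j : continuous (fun s => cov_density s i j).
Proof.
move: i j; apply: continuous_mulmx_entries.
  apply: continuous_mulmx_entries; first exact: continuous_expmx.
  by move=> i j s; exact: cst_continuous.
move=> i j s; under eq_fun do rewrite mxE; exact: continuous_expmx.
Qed.

Lemma continuous_qform_cov_density v : continuous (fun s => qform (cov_density s) v).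
Proof.
move=> s; under eq_fun do rewrite qform_sum.
apply: cvg_big => [|i _]; first exact: add_continuous.
apply: cvg_big => [|j _]; first exact: add_continuous.
by apply: cvgM; [exact: cvg_cst|exact: continuous_cov_density].
Qed.

(** The form is linear in the matrix entries, so the entrywise integral becomes a scalar one, to
    which positivity and splitting of the interval apply. *)
Lemma qform_tcovmx t v : 0 < t ->
  qform (tcovmx t) v = \int[mu]_(s in `[0, t]) qform (cov_density s) v.
Proof.
move=> t0.
have c i j : continuous (fun s => v i ord0 * v j ord0 * cov_density s i j).
  by move=> s; apply: cvgM; [exact: cvg_cst|exact: continuous_cov_density].
under eq_Rintegral do rewrite qform_sum.
rewrite Rintegral_sum_continuous; last first.
  by move=> i s; apply: cvg_big => [|j _]; [exact: add_continuous|exact: c].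
rewrite qform_sum tcovmxE //; apply: eq_bigr => i _.
rewrite Rintegral_sum_continuous //; apply: eq_bigr => j _.
rewrite mxE RintegralZl //.
by apply: continuous_integrable_itv; exact: continuous_cov_density.
Qed.

Lemma qform_cov_density_ge0 s v : 0 <= qform (cov_density s) v.
Proof. by rewrite qform_congr; exact: Qge0. Qed.

Lemma tcovmx_sym t : 0 < t -> (tcovmx t)^T = tcovmx t.
Proof.
move=> t0; rewrite tcovmxE //; apply/matrixP => i j; rewrite !mxE.
apply: eq_Rintegral => s _.
suff {1}<- : (cov_density s)^T = cov_density s by rewrite mxE.
by rewrite !trmx_mul trmxK Qsym mulmxA.
Qed.

Lemma qform_tcovmx_ge0 t v : 0 < t -> 0 <= qform (tcovmx t) v.
Proof.
by move=> t0; rewrite qform_tcovmx //; apply: Rintegral_ge0 => s _;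
  exact: qform_cov_density_ge0.
Qed.

Lemma qform_cov_densityD1 s v :
  qform (cov_density (s + 1)) v = qform (cov_density s) ((expmx B)^T *m v).
Proof.
rewrite -qform_congr /cov_density addrC expmxD scale1r.
by congr (qform _ _); rewrite !trmx_mul !mulmxA.
Qed.

(** The interval is split at 1 and its second piece shifted back to 0; $e^{(s+1)B}=e^Be^{sB}$ pulls
    the extra factor out as a congruence. An identity of forms is all that determinant
    superadditivity asks for. *)
Lemma qform_tcovmxD1 t v : 0 < t ->
  qform (tcovmx (t + 1)) v =
  qform (tcovmx 1) v + qform (expmx B *m tcovmx t *m (expmx B)^T) v.
Proof.
move=> t0; have t1 : 0 < t + 1 by rewrite addr_gt0.
rewrite [X in _ = _ + X]qform_congr [LHS](qform_tcovmx _ t1).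
rewrite [X in _ = X + _](qform_tcovmx _ ltr01).
rewrite [X in _ = _ + X](qform_tcovmx _ t0).
rewrite [LHS](Rintegral_split1 (ltW t0) (@continuous_qform_cov_density v)).
congr (_ + _); apply: eq_Rintegral => s _.
by rewrite qform_cov_densityD1.
Qed.

Hypothesis Kunit : forall t : R, 0 < t -> covmx Q B t \in unitmx.

(** An integral of nonnegative forms is only semidefinite; invertibility of $K(t)$ upgrades it. *)
Lemma posdefmx_tcovmx t : 0 < t -> posdefmx (tcovmx t).
Proof.
move=> t0; apply: unitmx_posdefmx.
- exact: tcovmx_sym.
- by move=> v; exact: qform_tcovmx_ge0.
- by rewrite unitmxZ ?Kunit // unitfE gt_eqF.
Qed.

Lemma det_tcovmxD1 t : (0 < n)%N -> 0 <= \tr B -> 0 < t ->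
  \det (tcovmx 1) + \det (tcovmx t) <= \det (tcovmx (t + 1)).
Proof.
move=> n0 trB t0; have pt := posdefmx_tcovmx t0.
have uE : expmx B \in unitmx.
  by rewrite unitmxE -[B]scale1r det_expmx unitfE gt_eqF // expR_gt0.
have := det_posdefmx_superadd n0 (posdefmx_tcovmx ltr01)
  (posdefmx_congr uE pt) (posdefmx_tcovmx (addr_gt0 t0 ltr01)).
rewrite !det_mulmx det_tr => H; apply: le_trans (H _); last first.
  by move=> v; rewrite addrC [leRHS]qform_tcovmxD1 // addrC.
rewrite lerD2l mulrAC ler_peMl ?(ltW (det_posdefmx_gt0 pt)) //.
have e1 : 1 <= \det (expmx B).
  by rewrite -[B]scale1r det_expmx mul1r -expR0 ler_expR.
by rewrite -[leLHS]mulr1 ler_pM.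
Qed.

(** The strict inequality keeps [t - 1] positive at each unit step down, where $C(t-1)$ must still
    be positive definite. *)
Lemma det_tcovmx_ge t k : (0 < n)%N -> 0 <= \tr B -> k%:R < t ->
  k%:R * \det (tcovmx 1) <= \det (tcovmx t).
Proof.
move=> n0 trB; elim: k t => [|k IH] t kt.
  by rewrite mul0r ltW // det_posdefmx_gt0 //; exact: posdefmx_tcovmx.
have kt1 : k%:R < t - 1 by rewrite ltrBrDr natr1.
have t1 : 0 < t - 1 by apply: le_lt_trans kt1.
rewrite -[t](subrK 1); apply: le_trans (det_tcovmxD1 n0 trB t1).
by rewrite -nat1r mulrDl mul1r lerD2l IH.
Qed.

End integrated_covariance.

(** * Gaussian integrals in every dimension *)

Section gaussian_integral.
Context {R : realType}.
Local Open Scope ereal_scope.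

Lemma integral_gauss_affine (a c : R) : (0 < a)%R ->
  \int[@lebesgue_measure R]_x (expR (- (a * (x + c) ^+ 2)))%:E =
  (Num.sqrt (pi / a))%:E.
Proof.
(* The integrand is a multiple of the normal density with mean $-c$ and variance $s^2=1/(2a)$. *)
move=> a0; pose s := Num.sqrt (2 * a)^-1.
have s2 : (s ^+ 2 = (2 * a)^-1)%R by rewrite sqr_sqrtr // invr_ge0 mulr_ge0 // ltW.
have s0 : (s != 0)%R by rewrite -sqrf_eq0 s2 invr_eq0 mulf_neq0 // gt_eqF.
have pE : ((normal_peak s)^-1 = Num.sqrt (pi / a))%R.
  rewrite /normal_peak invrK s2 -mulr_natr; congr Num.sqrt.
  by field; rewrite gt_eqF.
have -> : (fun x => (expR (- (a * (x + c) ^+ 2)))%:E) =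
    (fun x => (Num.sqrt (pi / a))%:E * (normal_pdf (- c) s x)%:E).
  apply/funext => x; 
  have -> : normal_pdf (- c) s x = (normal_peak s * normal_fun (- c) s x)%R.
    by rewrite normal_pdfE.
  rewrite -EFinM; congr EFin.
  rewrite -pE [RHS]mulrA mulVf ?mul1r ?gt_eqF ?normal_peak_gt0 // /normal_fun opprK s2.
  by congr expR; field; rewrite gt_eqF.
rewrite ge0_integralZl //.
- by rewrite integral_normal_pdf mule1.
- by apply/measurable_EFinP; exact: measurable_normal_pdf.
- by move=> x _; rewrite lee_fin normal_pdf_ge0.
Qed.

(** Tonelli for the recursively built measure, with the new coordinate innermost so that it can be
    integrated out for fixed [w]. *)
Lemma integral_borel_lebesgueS n (f : 'cV[R]_(1 + n) -> \bar R) :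
  measurable_fun setT f -> (forall v, 0 <= f v) ->
  \int[borel_lebesgue n.+1]_v f v =
  \int[borel_lebesgue n]_w \int[@lebesgue_measure R]_x f (col_mx (const_mx x) w).
Proof.
move=> mf f0.
rewrite [LHS](@ge0_integral_pushforward _ _ _ _ _ _ (@measurable_cons_cV R n)) //.
rewrite preimage_setT fubini_tonelli2 //.
- exact: measurableT_comp mf (@measurable_cons_cV R n).
- by move=> x; exact: f0.
Qed.

Lemma measurable_qform d (T : measurableType d) n (S : 'M[R]_n) (h : T -> 'cV[R]_n) :
  (forall i, measurable_fun setT (fun x => h x i ord0)) ->
  measurable_fun setT (fun x => qform S (h x)).
Proof.
move=> mh; under eq_fun do rewrite qform_sum.
apply: measurable_sum => i; apply: measurable_sum => j.
by apply: measurable_funM => //; apply: measurable_funM.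
Qed.

Lemma measurable_mulmx_entries d (T : measurableType d) m n (A : 'M[R]_(m, n))
    (h : T -> 'cV[R]_n) :
  (forall i, measurable_fun setT (fun x => h x i ord0)) ->
  forall i, measurable_fun setT (fun x => (A *m h x) i ord0).
Proof.
move=> mh i; under eq_fun do rewrite mxE.
by apply: measurable_sum => j; apply: measurable_funM.
Qed.

Lemma col_mx_const_subr n (x : R) (w : 'cV[R]_n) (m : 'cV[R]_(1 + n)) :
  (col_mx (const_mx x) w - m =
   col_mx (const_mx (x - m ord0 ord0)) (w - dsubmx m))%R.
Proof.
apply/matrixP => i j; rewrite {j}ord1.
case: (split_ordP i) => k ->{i}; rewrite [LHS]mxE.
  rewrite !col_mxEu !mxE ord1; congr (_ - m _ _)%R; exact: val_inj.
by rewrite !col_mxEd !mxE.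
Qed.

(** By [qform_schur] the inner integral is a shifted one-dimensional Gaussian whose value
    $\sqrt{\pi/S_{00}}$ does not depend on the shift. What remains is the Gaussian of the Schur
    complement, and [det_schur] recombines the constants. *)
Lemma integral_gauss_cV n (S : 'M[R]_n) (m : 'cV[R]_n) : posdefmx S ->
  \int[borel_lebesgue n]_v (expR (- qform S (v - m)))%:E =
  (Num.sqrt (pi ^+ n / \det S))%:E.
Proof.
elim: n S m => [|n IH] S m pS.
  rewrite integral_dirac //=; last first.
    apply/measurable_EFinP; apply: measurableT_comp => //.
    apply: measurableT_comp => //; apply: measurable_qform => -[].
    by [].
  by rewrite diracT mul1e /qform /dotv big_ord0 det_mx00 oppr0 expR0
    expr0 divr1 sqrtr1.
have a0 := posdefmx_00 pS; have dS := det_posdefmx_gt0 (posdefmx_schur pS).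
rewrite integral_borel_lebesgueS; last 2 first.
- apply/measurable_EFinP; apply: measurableT_comp => //.
  apply: measurableT_comp => //; apply: measurable_qform => i.
  under eq_fun do rewrite mxE; apply: measurable_funD => //.
  exact: measurable_coord.
- by move=> v; rewrite lee_fin expR_ge0.
(* The shift for which $x+c(w)$ is the base of the completed square at [v - m]. *)
pose c (w : 'cV[R]_n) := (- m ord0 ord0 +
  (S ord0 ord0)^-1 * (ursubmx (S : 'M[R]_(1 + n)) *m (w - dsubmx (m : 'cV[R]_(1 + n)))) ord0 ord0)%R.
transitivity (\int[borel_lebesgue n]_w ((Num.sqrt (pi / S ord0 ord0))%:E *
    (expR (- qform (schur (S : 'M[R]_(1 + n))) (w - dsubmx (m : 'cV[R]_(1 + n)))))%:E)).
  apply: eq_integral => w _.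
  rewrite -(integral_gauss_affine (c w) a0) -ge0_integralZr //; last first.
    apply/measurable_EFinP; apply: measurableT_comp => //.
    apply: measurableT_comp => //; apply: measurable_funM => //.
    by apply: measurable_funX; exact: measurable_funD.
  apply: eq_integral => x _; rewrite -EFinM -expRD; congr (expR _)%:E.
  rewrite -opprD; congr (- _)%R.
  transitivity (qform (S : 'M[R]_(1 + n)) (col_mx
      (const_mx (x - m ord0 ord0)) (w - dsubmx (m : 'cV[R]_(1 + n)))))%R.
    exact: (congr1 (qform S) (col_mx_const_subr x w m)).
  rewrite qform_schur ?gt_eqF ?pS.1 //; congr (_ * _ ^+ 2 + _)%R.
  by rewrite mxE /c addrA.
rewrite ge0_integralZl //; last first.
  apply/measurable_EFinP; apply: measurableT_comp => //.
  apply: measurableT_comp => //; apply: measurable_qform => i.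
  under eq_fun do rewrite mxE; apply: measurable_funD => //.
  exact: measurable_coord.
rewrite IH; last exact: posdefmx_schur.
rewrite -EFinM -sqrtrM ?divr_ge0 ?pi_ge0 ?(ltW a0) //; congr (Num.sqrt _)%:E.
rewrite (@det_schur _ n) ?gt_eqF // exprS.
by field; rewrite !gt_eqF.
Qed.

End gaussian_integral.

(** * Passing between a measure and its completion *)

Section completion.
Context {d : measure_display} {T : measurableType d} {R : realType}.
Variable mu : {measure set T -> \bar R}.
Local Notation cT := (caratheodory_type (mu_ext mu)).
Local Notation cmu := (@completed_measure_extension d T R mu).
Local Open Scope ereal_scope.

Lemma measurable_caratheodory (A : set T) :
  measurable A -> measurable (A : set cT).
Proof. exact: caratheodory_measurable_mu_ext. Qed.

Lemma completedE (A : set T) : measurable A -> cmu A = mu A.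
Proof. exact: measurable_mu_extE. Qed.

Lemma measurable_fun_completed d' (U : measurableType d') (f : T -> U) :
  measurable_fun setT f -> measurable_fun setT (f : cT -> U).
Proof.
move=> mf _ A mA; apply: measurable_caratheodory; exact: mf.
Qed.

(** On measurable sets [mu] is the image of the completed measure under the identity map, so the
    pushforward formula applies. *)
Lemma integral_completed (f : T -> \bar R) :
  measurable_fun setT f -> (forall x, 0 <= f x) ->
  \int[cmu]_x f x = \int[mu]_x f x.
Proof.
move=> mf f0; have mid : measurable_fun setT (id : cT -> T).
  exact: (@measurable_fun_completed _ T id).
rewrite -(@eq_measure_integral _ _ _ _ mu (pushforward cmu (id : cT -> T))).
  by rewrite (ge0_integral_pushforward mid).
by move=> A mA _; exact: completedE.
Qed.

(** [F] intersects the unions of countable covers that are optimal up to $1/(n+1)$. Finiteness of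
    the measure allows subtraction, which makes the excess null. *)
Lemma completed_hull (E : set T) (m : R) :
  measurable (E : set cT) -> cmu E = m%:E ->
  exists F : set T, [/\ measurable F, E `<=` F, mu F = m%:E & cmu (F `\` E) = 0].
Proof.
move=> mE Em.
have inf_fin : ereal_inf [set \sum_(k <oo) mu (A k) | A in measurable_cover E]
    \is a fin_num by rewrite -[X in X \is a _]/(cmu E) Em.
have /(_ _)/cid H n : exists A, measurable_cover E A /\
    \sum_(k <oo) mu (A k) <= (m + n.+1%:R^-1)%:E.
  have n0 : (0 < n.+1%:R^-1 :> R)%R by rewrite invr_gt0.
  have [_ [A cA <-] /ltW leA] := lb_ereal_inf_adherent n0 inf_fin.
  exists A; split => //; apply: le_trans leA _.
  by rewrite -[X in X + _]/(cmu E) Em EFinD.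
pose A n := sval (H n).
have cA n : measurable_cover E (A n) by case: (svalP (H n)).
have leA n : \sum_(k <oo) mu (A n k) <= (m + n.+1%:R^-1)%:E by case: (svalP (H n)).
pose F := \bigcap_n \bigcup_k A n k.
have mG n : measurable (\bigcup_k A n k).
  by apply: bigcupT_measurable => k; case: (cA n).
have mF : measurable F by exact: bigcapT_measurable.
have EF : E `<=` F by move=> x Ex n _; case: (cA n) => _; exact.
have muF : mu F = m%:E.
  apply/eqP; rewrite eq_le; apply/andP; split; last first.
    rewrite -Em -(completedE mF); exact: le_mu_ext.
  apply/lee_addgt0Pr => e e0.
  have [n ne] : exists n, (n.+1%:R^-1 < e)%R.
    have [n _ /(_ n (leqnn _))] := near_infty_natSinv_lt (PosNum e0).
    by exists n.
  apply: (@le_trans _ _ (m + n.+1%:R^-1)%:E); last by rewrite -EFinD lee_fin lerD2l ltW.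
  apply: le_trans (leA n).
  apply: measure_sigma_subadditive => //; first by case: (cA n).
  by move=> x Fx; exact: Fx.
exists F; split => //.
have mcF := measurable_caratheodory mF.
have := @measureU _ _ _ cmu E (F `\` E) mE (measurableD mcF mE).
rewrite setIDA setIidl // setDv (setDUK EF) => /(_ erefl) cmuF.
have {cmuF} : m%:E = m%:E + cmu (F `\` E).
  have FE : cmu F = m%:E := etrans (completedE mF) muF.
  exact: etrans (etrans (esym FE) cmuF) (congr1 (fun z => z + _) Em).
have : 0 <= cmu (F `\` E) by exact: measure_ge0.
case: (cmu (F `\` E)) => [r|//|//] _; rewrite -EFinD => -[mr].
by congr EFin; lra.
Qed.

(** Trading [E] for its hull changes the integrand on a null set only. The conditional form fits
    both the inner and the outer integral of the exchange. *)
Lemma integral_completed_if (E F : set T) (g h : T -> \bar R) :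
  measurable (E : set cT) -> measurable F -> E `<=` F -> cmu (F `\` E) = 0 ->
  measurable_fun setT g -> (forall x, 0 <= g x) ->
  measurable_fun setT h -> (forall x, 0 <= h x) ->
  \int[cmu]_x (if x \in E then g x else h x) =
  \int[mu]_x (if x \in F then g x else h x).
Proof.
move=> mE mF EF FE0 mg g0 mh h0.
have ifE (A : set T) : (fun x => if x \in A then g x else h x) =
    (fun x => g x * (\1_A x)%:E + h x * (\1_(~` A) x)%:E).
  apply/funext => x; rewrite !indicE in_setC; case: (x \in A) => /=.
    by rewrite mule1 mule0 adde0.
  by rewrite mule1 mule0 add0e.
have mindic d' (U : measurableType d') (A : set U) :
    measurable A -> measurable_fun setT (fun x => (\1_A x)%:E : \bar R).
  by move=> mA; apply/measurable_EFinP; exact: measurable_indic.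
have mif : measurable_fun setT (fun x => if x \in F then g x else h x).
  rewrite ifE; apply: emeasurable_funD; apply: emeasurable_funM.
  - exact: mg.
  - exact: mindic.
  - exact: mh.
  - by apply: mindic; exact: measurableC.
have if0 (A : set T) x : 0 <= (if x \in A then g x else h x) by case: ifP.
transitivity (\int[cmu]_x (if x \in F then g x else h x)); last first.
  by apply: integral_completed => [|x]; [exact: mif|exact: if0].
apply: ge0_ae_eq_integral; [exact: measurableT| | | | |].
- rewrite ifE; apply: emeasurable_funD; apply: emeasurable_funM.
  + exact: measurable_fun_completed mg.
  + exact: (mindic _ cT).
  + exact: measurable_fun_completed mh.
  + by apply: (mindic _ cT); exact: measurableC.
- exact: measurable_fun_completed mif.
- by move=> x _; exact: if0.
- by move=> x _; exact: if0.
- exists (F `\` E); split; [|exact: FE0|].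
    by apply: measurableD; [exact: measurable_caratheodory|exact: mE].
  move=> x /= nx; apply: contrapT => FEx; apply: nx => _.
  rewrite (_ : (x \in E) = (x \in F)) //; apply/idP/idP; rewrite !inE; first exact: EF.
  by move=> Fx; apply: contrapT => nEx; apply: FEx.
Qed.

End completion.

(** * Exchange between a set and its complement under a bounded kernel *)

Section exchange.
Context {d : measure_display} {T : measurableType d} {R : realType}.
Variables (mu : {sigma_finite_measure set T -> \bar R}) (k : T * T -> R).
Variables (c r : R).
Hypothesis mk : measurable_fun setT k.
Hypothesis k0 : forall z, 0 <= k z.
Hypothesis kc : forall z, k z <= c.
Local Notation cmu := (@completed_measure_extension d T R mu).
Local Open Scope ereal_scope.
Hypothesis k1 : forall x, \int[mu]_y (k (x, y))%:E = 1.
Hypothesis kr : forall y, \int[mu]_x (k (x, y))%:E = r%:E.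

Let iint (f : T * T -> R) := \int[mu]_x \int[mu]_y (f (x, y))%:E.

Let iintE (f : T * T -> R) : measurable_fun setT f -> (forall z, 0 <= f z)%R ->
  iint f = \int[mu \x mu]_z (f z)%:E.
Proof.
move=> mf f0; rewrite /iint fubini_tonelli1 //.
exact/measurable_EFinP.
Qed.

Let iintD (f g : T * T -> R) : measurable_fun setT f -> (forall z, 0 <= f z)%R ->
  measurable_fun setT g -> (forall z, 0 <= g z)%R ->
  iint (f \+ g)%R = iint f + iint g.
Proof.
move=> mf f0 mg g0; rewrite !iintE //; last 2 first.
- exact: measurable_funD.
- by move=> z; rewrite addr_ge0.
under eq_integral do rewrite EFinD.
rewrite ge0_integralD //; [by move=> z _; rewrite lee_fin| |by move=> z _; rewrite lee_fin|];
  exact/measurable_EFinP.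
Qed.

Let iint_le (f g : T * T -> R) : measurable_fun setT f -> (forall z, 0 <= f z)%R ->
  measurable_fun setT g -> (forall z, f z <= g z)%R -> iint f <= iint g.
Proof.
move=> mf f0 mg fg; have g0 z : (0 <= g z)%R by apply: le_trans (fg z).
rewrite !iintE //; apply: ge0_le_integral => //.
- by move=> z _; rewrite lee_fin.
- exact/measurable_EFinP.
- exact/measurable_EFinP.
- by move=> z _; rewrite lee_fin.
Qed.

Section measurable_set.
Variables (F : set T) (m : R).
Hypotheses (mF : measurable F) (Fm : mu F = m%:E).

Let mF1 : measurable_fun setT (fun z : T * T => \1_F z.1 : R).
Proof. by apply: measurableT_comp => //; exact: measurable_fst. Qed.

Let mF2 : measurable_fun setT (fun z : T * T => \1_F z.2 : R).
Proof. by apply: measurableT_comp => //; exact: measurable_snd. Qed.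

Let integral_F (a : R) : (0 <= a)%R -> \int[mu]_x (a * \1_F x)%:E = (a * m)%:E.
Proof.
move=> a0; under eq_integral do rewrite EFinM.
rewrite ge0_integralZl ?lee_fin //.
- by rewrite integral_indic // setIT EFinM; congr (_ * _); exact: Fm.
- exact/measurable_EFinP.
Qed.

Let iint_F1 : iint (fun z => k z * \1_F z.1)%R = m%:E.
Proof.
transitivity (\int[mu]_x (1 * \1_F x)%:E); last by rewrite integral_F // mul1r.
apply: eq_integral => x _; rewrite mul1r /=.
under eq_integral do rewrite EFinM.
rewrite ge0_integralZr ?lee_fin //=; last 2 first.
- by apply/measurable_EFinP; exact: measurableT_comp.
- by move=> y _; rewrite lee_fin.
by rewrite k1 mul1e.
Qed.

Let r0 : (0 <= r)%R.
Proof.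
by rewrite -lee_fin -(kr point); apply: integral_ge0 => x _; rewrite lee_fin.
Qed.

(** Here the mass of [k] is taken in the first variable, so the order of integration is swapped
    beforehand. *)
Let iint_F2 : iint (fun z => k z * \1_F z.2)%R = (r * m)%:E.
Proof.
rewrite iintE; last 2 first.
- exact: measurable_funM.
- by move=> z; rewrite mulr_ge0.
rewrite fubini_tonelli2; last 2 first.
- by apply/measurable_EFinP; exact: measurable_funM.
- by move=> z; rewrite lee_fin mulr_ge0.
rewrite -integral_F //; apply: eq_integral => y _; rewrite /fubini_G /=.
under eq_integral do rewrite EFinM.
rewrite ge0_integralZr ?lee_fin //=; last 2 first.
- by apply/measurable_EFinP; exact: measurableT_comp.
- by move=> x _; rewrite lee_fin.
by rewrite kr EFinM.
Qed.

Let c0 : (0 <= c)%R.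
Proof. exact: le_trans (k0 (point, point)) (kc _). Qed.

Let iint_FF : iint (fun z => c * (\1_F z.1 * \1_F z.2))%R = (c * m ^+ 2)%:E.
Proof.
have m0 : (0 <= m)%R by rewrite -lee_fin -Fm.
transitivity (\int[mu]_x ((c * m) * \1_F x)%:E); last first.
  by rewrite integral_F ?mulr_ge0 // -mulrA -expr2.
apply: eq_integral => x _ /=.
under eq_integral do rewrite mulrA.
by rewrite integral_F ?mulr_ge0 //; congr EFin; ring.
Qed.

Lemma exchange_bounds :
  (m + r * m - 2 * (c * m ^+ 2))%:E <=
    \int[mu]_x \int[mu]_y (k (x, y) * `|\1_F y - \1_F x|)%:E <= (m + r * m)%:E.
Proof.
pose f z : R := (k z * `|\1_F z.2 - \1_F z.1|)%R.
pose g z : R := (k z * (\1_F z.1 * \1_F z.2))%R.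
have mf : measurable_fun setT f.
  apply: measurable_funM => //; apply: measurableT_comp => //.
  exact: measurable_funB.
have mg : measurable_fun setT g.
  by apply: measurable_funM => //; exact: measurable_funM.
have f0 z : (0 <= f z)%R by rewrite mulr_ge0.
have g0 z : (0 <= g z)%R by rewrite !mulr_ge0.
(* The relation is stated as a sum rather than a difference, since these integrals take extended
   values and their finiteness is only deduced below. *)
have : iint (f \+ (g \+ g))%R = (m + r * m)%:E.
  rewrite EFinD; have [<- <-] := (iint_F1, iint_F2).
  rewrite -[RHS]iintD; last 4 first.
  - exact: measurable_funM.
  - by move=> z; rewrite mulr_ge0.
  - exact: measurable_funM.
  - by move=> z; rewrite mulr_ge0.
  apply: eq_integral => x _; apply: eq_integral => y _; congr EFin.
  rewrite /f /g /= !indicE.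
  by case: (x \in F); case: (y \in F) => /=;
    rewrite ?(subrr, subr0, sub0r, normrN, normr1, normr0) /=; ring.
rewrite !iintD //; last 2 first.
- exact: measurable_funD.
- by move=> z; rewrite addr_ge0.
have gle : iint g <= (c * m ^+ 2)%:E.
  rewrite -iint_FF; apply: iint_le => //.
    by apply: measurable_funM => //; exact: measurable_funM.
  by move=> z; rewrite ler_wpM2r // mulr_ge0.
have fE : iint f = \int[mu]_x \int[mu]_y (k (x, y) * `|\1_F y - \1_F x|)%:E by [].
have : 0 <= iint f by do 2![apply: integral_ge0 => ? _]; rewrite lee_fin.
have : 0 <= iint g by do 2![apply: integral_ge0 => ? _]; rewrite lee_fin.
rewrite -fE; case: (iint g) gle => [b||] //; case: (iint f) => [a||] //.
rewrite !lee_fin => bc b0 a0; rewrite -!EFinD => -[] H.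
apply/andP; split; lra.
Qed.

End measurable_set.

(** Tonelli is used for the hull [F] only. The inner integral is moved to [F] with the value [e] of
    $\mathbf 1_E(x)$ frozen; the outer integrand is then [H 1] on [E] and [H 0] off it, and is moved
    in the same way. *)
Lemma completed_exchange_bounds (E : set T) (m : R) :
  (mu_ext mu).-cara.-measurable E -> cmu E = m%:E ->
  (m + r * m - 2 * (c * m ^+ 2))%:E <=
    \int[cmu]_x \int[cmu]_y (k (x, y) * `|\1_E y - \1_E x| `^ 1)%:E <= (m + r * m)%:E.
Proof.
move=> mE Em; have [F [mF EF Fm FE0]] := completed_hull mE Em.
pose H (e : R) x := \int[mu]_y (k (x, y) * `|\1_F y - e|)%:E.
have H0 e x : 0 <= H e x.
  by apply: integral_ge0 => y _; rewrite lee_fin mulr_ge0.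
have mH e : measurable_fun setT (H e).
  apply: (@measurable_fun_fubini_tonelli_F _ _ _ _ _ mu
    (fun z => (k z * `|\1_F z.2 - e|)%:E)).
  - apply/measurable_EFinP; apply: measurable_funM => //.
    apply: measurableT_comp => //; apply: measurable_funB => //.
    by apply: measurableT_comp => //; exact: measurable_snd.
  - by move=> z; rewrite lee_fin mulr_ge0.
have mk2 x (a : R) : measurable_fun setT (fun y => (k (x, y) * a)%:E).
  apply/measurable_EFinP; apply: measurable_funM; last exact: measurable_cst.
  exact: measurableT_comp.
have inner x : \int[cmu]_y (k (x, y) * `|\1_E y - \1_E x| `^ 1)%:E =
    if x \in E then H 1%R x else H 0%R x.
  have H_if (e : R) : \int[cmu]_y (k (x, y) * `|\1_E y - e| `^ 1)%:E = H e x.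
    rewrite (_ : (fun y => _) = (fun y => if y \in E then (k (x, y) * `|1 - e|)%:E
        else (k (x, y) * `|0 - e|)%:E)); last first.
      by apply/funext => y; rewrite powRr1 // indicE; case: (y \in E).
    rewrite (integral_completed_if mE mF EF FE0) //.
    - by apply: eq_integral => y _; rewrite indicE; case: (y \in F).
    - by move=> y; rewrite lee_fin mulr_ge0.
    - by move=> y; rewrite lee_fin mulr_ge0.
  by rewrite H_if indicE; case: (x \in E).
rewrite (_ : \int[cmu]_x _ =
    \int[mu]_x \int[mu]_y (k (x, y) * `|\1_F y - \1_F x|)%:E).
  exact: exchange_bounds.
transitivity (\int[cmu]_x (if x \in E then H 1%R x else H 0%R x)).
  by apply: eq_integral => x _; exact: inner.
rewrite (integral_completed_if mE mF EF FE0) //.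
by apply: eq_integral => x _; rewrite /H indicE; case: (x \in F).
Qed.

End exchange.

(** * The transition density as a Gaussian in each variable *)

Section heat_kernel_theory.
Context {R : realType} {N : nat} (Q B : 'M[R]_N).
Hypothesis Qsym : Q^T = Q.
Hypothesis Qge0 : forall v : 'cV[R]_N, 0 <= dotv (Q *m v) v.
Hypothesis Kunit : forall t : R, 0 < t -> covmx Q B t \in unitmx.
Variable t : R.
Hypothesis t0 : 0 < t.

(** The value of the kernel at $Y=e^{tB}X$, which is its maximum. *)
Definition heat_peak : R :=
  (4 * pi) `^ (- (N%:R / 2)) / Num.sqrt (\det (tcovmx Q B t)).

(** Equal to $K(t)^{-1}/(4t)$, with the scalar $t$ absorbed into $C(t)^{-1}$. *)
Definition heat_form : 'M[R]_N := 4^-1 *: invmx (tcovmx Q B t).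

Lemma heat_kernelE X Y : heat_kernel Q B X Y t =
  heat_peak * expR (- qform heat_form (Y - expmx (t *: B) *m X)).
Proof.
rewrite /heat_kernel -/(tcovmx Q B t) -/heat_peak; congr (_ * expR (- _)).
have uK : t *: covmx Q B t \in unitmx by rewrite unitmxZ ?unitfE ?gt_eqF ?Kunit.
rewrite /qform /heat_form -scalemxAl dotvZl /tcovmx (@invmxZ _ _ t) //.
by rewrite -scalemxAl dotvZl invfM; ring.
Qed.

Let posC : posdefmx (tcovmx Q B t). Proof. exact: posdefmx_tcovmx. Qed.

Lemma posdefmx_heat_form : posdefmx heat_form.
Proof. by apply: posdefmxZ; [rewrite invr_gt0|exact: posdefmxV]. Qed.

Lemma det_heat_form : \det heat_form = (4 ^+ N * \det (tcovmx Q B t))^-1.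
Proof. by rewrite detZ det_inv exprVn invfM. Qed.

Lemma heat_peak_ge0 : 0 <= heat_peak.
Proof. by rewrite divr_ge0 ?powR_ge0. Qed.

(** The parameter covers both marginals: $d=1$ gives mass one in $Y$, and $d=(\det e^{tB})^2$ gives
    $e^{-t\operatorname{tr}B}$ in $X$. *)
Lemma heat_peakE (d : R) : 0 <= d ->
  heat_peak * Num.sqrt (pi ^+ N / (d * \det heat_form)) = (Num.sqrt d)^-1.
Proof.
move=> d0; have C0 := det_posdefmx_gt0 posC.
have pi4 : 0 < (4 * pi) ^+ N :> R by rewrite exprn_gt0 // mulr_gt0 ?pi_gt0.
have -> : pi ^+ N / (d * \det heat_form) = ((4 * pi) ^+ N * \det (tcovmx Q B t)) * d^-1.
  by rewrite det_heat_form invfM invrK exprMn; ring.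
rewrite sqrtrM ?(ltW (mulr_gt0 _ _)) // sqrtrM ?(ltW pi4) // sqrtrV //.
rewrite /heat_peak powRN powRrM powR12_sqrt ?powR_ge0 // powR_mulrn ?mulr_ge0 ?pi_ge0 //.
rewrite -[RHS]mul1r; set u := Num.sqrt _; set v := Num.sqrt _.
have u0 : u != 0 by rewrite gt_eqF // sqrtr_gt0.
have v0 : v != 0 by rewrite gt_eqF // sqrtr_gt0.
by rewrite mulrA; congr (_ * _); field; rewrite u0 v0.
Qed.

Lemma heat_kernel_ge0 X Y : 0 <= heat_kernel Q B X Y t.
Proof. by rewrite heat_kernelE mulr_ge0 ?heat_peak_ge0 ?expR_ge0. Qed.

Lemma heat_kernel_le X Y : heat_kernel Q B X Y t <= heat_peak.
Proof.
rewrite heat_kernelE ler_piMr ?heat_peak_ge0 // -expR0 ler_expR oppr_le0.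
exact: posdefmx_ge0 posdefmx_heat_form.
Qed.

Lemma measurable_heat_kernel :
  measurable_fun setT (fun z : 'cV[R]_N * 'cV[R]_N => heat_kernel Q B z.1 z.2 t).
Proof.
under eq_fun do rewrite heat_kernelE.
apply: measurable_funM => //; apply: measurableT_comp => //.
apply: measurableT_comp => //; apply: measurable_qform => i.
under eq_fun do rewrite mxE [X in _ + X]mxE; apply: measurable_funB.
  by apply: (measurableT_comp (measurable_coord i)); exact: measurable_snd.
apply: measurable_mulmx_entries => j.
by apply: (measurableT_comp (measurable_coord j)); exact: measurable_fst.
Qed.

Local Open Scope ereal_scope.

Let measurable_gauss (S : 'M[R]_N) (m : 'cV[R]_N) :
  measurable_fun setT (fun v : 'cV[R]_N => (expR (- qform S (v - m)))%:E).
Proof.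
apply/measurable_EFinP; apply: measurableT_comp => //.
apply: measurableT_comp => //; apply: measurable_qform => i.
under eq_fun do rewrite mxE; apply: measurable_funD => //; exact: measurable_coord.
Qed.

Lemma integral_heat_kernel_r X :
  \int[borel_lebesgue N]_Y (heat_kernel Q B X Y t)%:E = 1.
Proof.
under eq_integral do rewrite heat_kernelE EFinM.
rewrite ge0_integralZl ?lee_fin ?heat_peak_ge0 //.
rewrite integral_gauss_cV; last exact: posdefmx_heat_form.
by rewrite -EFinM -[\det _]mul1r heat_peakE // sqrtr1 invr1.
Qed.

(** With $A=e^{tB}$, $Y-AX=-A(X-A^{-1}Y)$, so the kernel is a Gaussian in $X$ whose form is the
    congruence by $A$, with determinant multiplied by $(\det A)^2$. *)
Lemma integral_heat_kernel_l Y :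
  \int[borel_lebesgue N]_X (heat_kernel Q B X Y t)%:E = (expR (- t * \tr B))%:E.
Proof.
set A := expmx (t *: B); have dA : \det A = expR (t * \tr B) by rewrite det_expmx.
have uA : A \in unitmx by rewrite unitmxE dA unitfE gt_eqF ?expR_gt0.
have uAT : A^T \in unitmx by rewrite unitmx_tr.
have E X : heat_kernel Q B X Y t =
    (heat_peak * expR (- qform (A^T *m heat_form *m A) (X - invmx A *m Y)))%R.
  have -> : A^T *m heat_form *m A = A^T *m heat_form *m (A^T)^T by rewrite trmxK.
  rewrite heat_kernelE -/A qform_congr trmxK.
  congr (_ * expR (- _))%R.
  by rewrite mulmxBr mulKVmx // -(opprB Y) qformN.
under eq_integral do rewrite E EFinM.
rewrite ge0_integralZl ?lee_fin ?heat_peak_ge0 //.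
rewrite integral_gauss_cV; last first.
  by rewrite -[A in _ *m A]trmxK; apply: posdefmx_congr; [|exact: posdefmx_heat_form].
have -> : (\det (A^T *m heat_form *m A) = \det A ^+ 2 * \det heat_form)%R.
  by rewrite !det_mulmx det_tr; ring.
rewrite -EFinM heat_peakE ?sqr_ge0 //.
by rewrite sqrtr_sqr dA ger0_norm ?expR_ge0 // mulNr expRN.
Qed.

End heat_kernel_theory.

(** * Integral bounds through simple minorants *)

Section lower_integral.
Context {d : measure_display} {T : measurableType d} {R : realType}.
Variable mu : {measure set T -> \bar R}.
Local Open Scope ereal_scope.
Import HBNNSimple.

(* For a nonnegative function the library's integral is the supremum over the
   simple functions below it, so these bounds need no measurability. *)
Lemma le_lower_integral (A D : set T) (f g : T -> \bar R) : A `<=` D ->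
  (forall x, A x -> 0 <= f x) -> (forall x, D x -> 0 <= g x) ->
  (forall x, A x -> f x <= g x) ->
  \int[mu]_(x in A) f x <= \int[mu]_(x in D) g x.
Proof.
move=> AD f0 g0 fg; rewrite !ge0_integralE //; apply: le_ereal_sup => _ [h hf <-].
exists h => // x; apply: le_trans (hf x) _; rewrite !patchE.
case: (boolP (x \in A)) => [xA|_].
  by rewrite (mem_set (AD _ (set_mem xA))); apply: fg; exact: set_mem.
by case: ifPn => // /set_mem/g0.
Qed.

Lemma lower_integral_le (D : set T) (f : T -> \bar R) M :
  (forall x, D x -> 0 <= f x) ->
  (forall h, measurable_fun setT h -> (forall x, 0 <= h x) ->
    (forall x, h x <= (f \_ D) x) -> \int[mu]_x h x <= M) ->
  \int[mu]_(x in D) f x <= M.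
Proof.
move=> f0 hM; rewrite ge0_integralE //; apply: ge_ereal_sup => _ [h hf <-].
have <- : \int[mu]_x (h x)%:E = sintegral mu h by rewrite integral_nnsfun // patch_setT.
apply: hM => //.
- by apply/measurable_EFinP; exact: measurable_funPT.
- by move=> x; rewrite lee_fin.
Qed.

End lower_integral.

(** * Tails of power integrals *)

Section power_tail.
Context {R : realType}.
Local Notation mu := (@lebesgue_measure R).

Lemma powRN_cvg0 (s : R) : 0 < s -> x `^ (- s) @[x --> +oo] --> (0 : R).
Proof.
move=> s0; apply/cvgrPdist_le => /= e e0; near=> x.
have x0 : 0 < x by near: x; exact: nbhs_pinfty_gt.
rewrite sub0r normrN ger0_norm ?powR_ge0 // powRN -[leRHS]invrK.
rewrite lef_pV2 ?posrE ?invr_gt0 ?powR_gt0 //.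
have <- : ((e^-1) `^ (s^-1)) `^ s = e^-1.
  by rewrite -powRrM mulVf ?gt_eqF // powRr1 ?invr_ge0 // ltW.
apply: ge0_ler_powR; rewrite ?nnegrE ?powR_ge0 ?(ltW x0) ?(ltW s0) //.
Unshelve. all: by end_near. Qed.

Lemma integral_power_tail (T s : R) : 0 < T -> 0 < s ->
  (\int[mu]_(t in `]T, +oo[) ((t `^ (s + 1))^-1)%:E = (T `^ (- s) / s)%:E)%E.
Proof.
move=> T0 s0; pose F (t : R) := - s^-1 * t `^ (- s).
have dF (t : R) : 0 < t -> is_derive t 1 F ((t `^ (s + 1))^-1).
  move=> t0; have -> : (t `^ (s + 1))^-1 = - s^-1 *: (- s * t `^ (- s - 1)).
    by rewrite /GRing.scale /= -powRN opprD mulrA mulrNN mulVf ?mul1r ?gt_eqF.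
  have := is_derive1_powR (- s) t0; exact: is_deriveZ.
have cf (t : R) : 0 < t -> {for t, continuous (fun t : R => (t `^ (s + 1))^-1)}.
  move=> t0.
  have c : {for t, continuous (fun t : R => t `^ (s + 1))}.
    apply/differentiable_continuous/derivable1_diffP.
    by case: (is_derive1_powR (s + 1) t0).
  by apply: (cvgV _ c); rewrite gt_eqF // powR_gt0.
have FT (t : R) : 0 < t -> {for t, continuous F}.
  by move=> t0; apply/differentiable_continuous/derivable1_diffP; case: (dF _ t0).
rewrite integral_itv_obnd_cbnd; last first.
  apply/measurable_EFinP.
  apply: (@eq_measurable_fun _ _ _ _ _ (fun t : R => t `^ (- (s + 1)))).
    by move=> t _; rewrite powRN.
  by apply: measurable_funTS; exact: measurable_powR.
rewrite [LHS](@ge0_continuous_FTC2y R (fun t : R => (t `^ (s + 1))^-1) F T 0) //.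
- by rewrite sub0e -EFinN /F mulNr opprK mulrC.
- by move=> x _; rewrite invr_ge0 powR_ge0.
- apply/continuous_within_itvcyP; split.
    move=> x; rewrite in_itv /= andbT => Tx; apply: cf; exact: lt_trans Tx.
  by apply: cvg_at_right_filter; exact: cf.
- rewrite -[0](mulr0 (- s^-1)); apply: cvgMl_tmp; exact: powRN_cvg0.
- by move=> x Tx; case: (dF x (lt_trans T0 Tx)).
- by apply: cvg_at_right_filter; exact: FT.
- move=> x; rewrite in_itv /= andbT => Tx.
  by rewrite derive1E; case: (dF x (lt_trans T0 Tx)).
Qed.

End power_tail.

(** * Limit of $s\int_0^\infty t^{-s-1}\varphi(t)\,dt$ as $s\to0^+$ *)

Section singular_integral.
Context {R : realType}.
Local Notation mu := (@lebesgue_measure R).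
Variables (phi : R -> \bar R) (L sigma : R).
Hypothesis phi0 : forall t, (0 <= phi t)%E.
Hypothesis L0 : 0 <= L.

Let weight (s t : R) : \bar R := (((t `^ (s + 1))^-1)%:E * phi t)%E.

Let weight_ge0 s t : (0 <= weight s t)%E.
Proof. by rewrite mule_ge0 // lee_fin invr_ge0 powR_ge0. Qed.

Definition singular_integral (s : R) : \bar R :=
  (\int[mu]_(t in `]0%R, +oo[) (((t `^ (s + 1))^-1)%:E * phi t))%E.

Lemma singular_integral_lower (s T a : R) : 0 < s -> 0 < T -> 0 <= a ->
  (forall t, T < t -> (a%:E <= phi t)%E) ->
  ((a * (T `^ (- s) / s))%:E <= singular_integral s)%E.
Proof.
move=> s0 T0 a0 aphi.
rewrite EFinM -(integral_power_tail T0 s0) -ge0_integralZl //; last 2 first.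
- apply/measurable_EFinP.
  apply: (@eq_measurable_fun _ _ _ _ _ (fun t : R => t `^ (- (s + 1)))).
    by move=> t _; rewrite powRN.
  by apply: measurable_funTS; exact: measurable_powR.
- by move=> t _; rewrite lee_fin invr_ge0 powR_ge0.
apply: le_lower_integral => //.
- by apply: subset_itvr; rewrite bnd_simp ltW.
- by move=> t _; rewrite mule_ge0 // lee_fin invr_ge0 powR_ge0.
- by move=> t _; exact: weight_ge0.
- move=> t; rewrite /= in_itv /= andbT => Tt; rewrite muleC.
  by apply: lee_wpmul2l; [rewrite lee_fin invr_ge0 powR_ge0|exact: aphi].
Qed.

(** The integral is split only for a measurable [h] below the integrand. On the head,
    $t^{-s-1}=t^{\sigma-s}t^{-\sigma-1}\le T^\sigma t^{-\sigma-1}$, where $T\ge1$ makes the constant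
    independent of $s$. *)
Lemma singular_integral_upper (s T b J : R) : 0 < s -> s <= sigma -> 1 <= T ->
  0 <= b -> (singular_integral sigma <= J%:E)%E ->
  (forall t, T < t -> (phi t <= b%:E)%E) ->
  (singular_integral s <= (T `^ sigma * J + b * (T `^ (- s) / s))%:E)%E.
Proof.
move=> s0 ssig T1 b0 IJ phib; have T0 : 0 < T by exact: lt_le_trans T1.
apply: lower_integral_le => [t _|h mh h0 hle]; first exact: weight_ge0.
have TE : `]0, +oo[%classic = `]0, T]%classic `|` `]T, +oo[%classic :> set R.
  by apply: itv_bndbnd_setU; rewrite bnd_simp ?ltW.
have -> : (\int[mu]_x h x = \int[mu]_(x in `]0%R, +oo[) h x)%E.
  rewrite [RHS]integral_mkcond; apply: eq_integral => x _; rewrite patchE.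
  case: ifPn => // x0; apply/eqP; rewrite eq_le h0 andbT.
  by have := hle x; rewrite patchE (negbTE x0).
rewrite TE ge0_integral_setU //=; last 2 first.
- exact: measurable_funTS.
- apply/disj_setPS => x [/=]; rewrite !in_itv /= andbT => /andP[_ xT].
  by rewrite ltNge xT.
rewrite EFinD; apply: leeD.
- have Ts0 : 0 < T `^ sigma by exact: powR_gt0.
  (* After division by $T^\sigma$, [h] lies below the integrand at [sigma], whose integral is at
     most [J]. *)
  apply: (@le_trans _ _ ((T `^ sigma)%:E *
    (\int[mu]_(x in `]0%R, T]) ((T `^ sigma)^-1%:E * h x)))%E); last first.
    rewrite EFinM; apply: lee_wpmul2l; first by rewrite lee_fin powR_ge0.
    apply: le_trans IJ; apply: le_lower_integral.
    + by apply: subset_itvl; rewrite bnd_simp.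
    + by move=> x _; rewrite mule_ge0 // lee_fin invr_ge0 powR_ge0.
    + by move=> x _; exact: weight_ge0.
    + move=> x; rewrite /= in_itv /= => /andP[x0 xT].
      rewrite lee_pdivrMl //; apply: le_trans (hle x) _.
      rewrite patchE mem_set /= ?in_itv /= ?x0 //.
      rewrite muleA; apply: lee_wpmul2r => //; rewrite -EFinM lee_fin.
      rewrite -!powRN; have -> : - (s + 1) = (sigma - s) + - (sigma + 1) by ring.
      rewrite powRD; last by rewrite (gt_eqF x0) implybT.
      rewrite ler_wpM2r ?powR_ge0 //.
      apply: (@le_trans _ _ (T `^ (sigma - s))).
        by apply: ge0_ler_powR; rewrite ?nnegrE ?subr_ge0 ?(ltW x0) ?(ltW T0).
      by apply: ler_powR => //; rewrite gerBl ltW.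
  rewrite ge0_integralZl ?lee_fin ?invr_ge0 ?powR_ge0 //; last exact: measurable_funTS.
  by rewrite muleA -EFinM divff ?gt_eqF // mul1e.
- rewrite EFinM -(integral_power_tail T0 s0) -ge0_integralZl //; last 2 first.
  + apply/measurable_EFinP.
    apply: (@eq_measurable_fun _ _ _ _ _ (fun t : R => t `^ (- (s + 1)))).
      by move=> t _; rewrite powRN.
    by apply: measurable_funTS; exact: measurable_powR.
  + by move=> t _; rewrite lee_fin invr_ge0 powR_ge0.
  apply: le_lower_integral => //.
  + by move=> t _; rewrite mule_ge0 // lee_fin invr_ge0 powR_ge0.
  + move=> t; rewrite /= in_itv /= andbT => Tt.
    apply: le_trans (hle t) _; rewrite patchE mem_set; last first.
      by rewrite /= in_itv /= andbT; exact: lt_trans Tt.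
    rewrite [leRHS]muleC.
    by apply: lee_wpmul2l; [rewrite lee_fin invr_ge0 powR_ge0|exact: phib].
Qed.

Hypothesis sigma0 : 0 < sigma.
Hypothesis Isigma : (singular_integral sigma < +oo)%E.
Hypothesis phiL : forall e, 0 < e -> exists T, forall t, T < t ->
  ((L - e)%:E <= phi t <= (L + e)%:E)%E.

(** In [bounds], one [e] pays for the variation of [phi] beyond [T]; the other pays for the head in
    the upper bound and for $1-T^{-s}$ in the lower one. *)
Lemma cvg_singular_integral :
  (s%:E * singular_integral s)%E @[s --> 0^'+] --> L%:E.
Proof.
have I0 s : (0 <= singular_integral s)%E.
  by apply: integral_ge0 => t _; exact: weight_ge0.
pose J := fine (singular_integral sigma).
have J0 : 0 <= J by rewrite fine_ge0.
have JE : (singular_integral sigma <= J%:E)%E by rewrite fineK // ge0_fin_numE.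
have bounds e : 0 < e -> \forall s \near 0^'+,
    ((L - (e + e))%:E <= s%:E * singular_integral s <= (L + (e + e))%:E)%E.
  move=> e0; have [T' HT'] := phiL e0.
  (* $T\ge1$ gives $\ln T\ge0$ and $T^{-s}\le1$. *)
  pose T := Num.max 1 T'.
  have T1 : 1 <= T by rewrite le_max lexx.
  have T0 : 0 < T by exact: lt_le_trans T1.
  have HT t : T < t -> ((L - e)%:E <= phi t <= (L + e)%:E)%E.
    by rewrite gt_max => /andP[_]; exact: HT'.
  have c0 : 0 <= T `^ sigma * J by rewrite mulr_ge0 ?powR_ge0.
  have l0 : 0 <= L * ln T by rewrite mulr_ge0 // ln_ge0.
  near=> s.
  have s0 : 0 < s by near: s; exact: nbhs_right_gt.
  have ssig : s <= sigma by near: s; exact: nbhs_right_le.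
  (* The thresholds in [s1] and [s2] bound $sT^\sigma J$ and $sL\ln T$ by [e]; the added 1 keeps the
     denominators positive. *)
  have s1 : s <= e / (T `^ sigma * J + 1).
    by near: s; apply: nbhs_right_le; rewrite divr_gt0 // ltr_wpDl.
  have s2 : s <= e / (L * ln T + 1).
    by near: s; apply: nbhs_right_le; rewrite divr_gt0 // ltr_wpDl.
  have Ts1 : T `^ (- s) <= 1.
    by rewrite -(powRr0 T); apply: ler_powR => //; rewrite oppr_le0 ltW.
  have Ts2 : 1 - s * ln T <= T `^ (- s).
    rewrite /powR gt_eqF //; apply: le_trans (expR_ge1Dx _).
    by rewrite mulNr.
  apply/andP; split.
    (* The tail estimate asks for a nonnegative lower bound of [phi]; when [L - e] is negative the
       claim follows from nonnegativity. *)
    have [Le|Le] := leP 0 (L - e); last first.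
      by apply: (@le_trans _ _ 0%E); [rewrite lee_fin; lra|rewrite mule_ge0 // lee_fin ltW].
    have H := singular_integral_lower s0 T0 Le (fun t Tt => proj1 (andP (HT t Tt))).
    have : (s%:E * ((L - e) * (T `^ (- s) / s))%:E <= s%:E * singular_integral s)%E.
      by apply: lee_wpmul2l => //; rewrite lee_fin ltW.
    apply: le_trans; rewrite -EFinM lee_fin.
    have -> : s * ((L - e) * (T `^ (- s) / s)) = (L - e) * T `^ (- s).
      by field; rewrite gt_eqF.
    have : (L - e) * (1 - s * ln T) <= (L - e) * T `^ (- s) by rewrite ler_wpM2l.
    apply: le_trans.
    have : s * (L * ln T + 1) <= e by rewrite -ler_pdivlMr // ltr_wpDl.
    have : 0 <= e * (s * ln T) by rewrite !mulr_ge0 ?ln_ge0 ?(ltW s0) ?(ltW e0).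
    by nra.
  have Le : 0 <= L + e by rewrite addr_ge0 // ltW.
  have H := singular_integral_upper s0 ssig T1 Le JE (fun t Tt => proj2 (andP (HT t Tt))).
  apply: (@le_trans _ _ (s%:E * (T `^ sigma * J + (L + e) * (T `^ (- s) / s))%:E)%E).
    by apply: lee_wpmul2l => //; rewrite lee_fin ltW.
  rewrite -EFinM lee_fin.
  have -> : s * (T `^ sigma * J + (L + e) * (T `^ (- s) / s)) =
      s * (T `^ sigma * J) + (L + e) * T `^ (- s) by field; rewrite gt_eqF.
  have : s * (T `^ sigma * J + 1) <= e by rewrite -ler_pdivlMr // ltr_wpDl.
  have : (L + e) * T `^ (- s) <= L + e by rewrite ler_piMr.
  by lra.
(* Convergence in the extended reals: the values are eventually finite, by [bounds] with [e] equal
   to 1, and then converge as reals. *)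
apply/fine_cvgP; split.
  near=> s; rewrite ge0_fin_numE; last first.
    by rewrite mule_ge0 // lee_fin ltW //; near: s; exact: nbhs_right_gt.
  have : ((L - (1 + 1))%:E <= s%:E * singular_integral s <= (L + (1 + 1))%:E)%E.
    by near: s; exact: bounds.
  by case/andP => _ /le_lt_trans; apply; exact: ltry.
apply/cvgrPdist_le => e e0; near=> s.
have : ((L - (e / 2 + e / 2))%:E <= s%:E * singular_integral s <= (L + (e / 2 + e / 2))%:E)%E.
  by near: s; apply: bounds; rewrite divr_gt0.
rewrite /=; case: (s%:E * singular_integral s)%E => [x||] //; last by case/andP.
by rewrite !lee_fin -splitr /= => /andP[? ?]; rewrite ler_distlC; apply/andP; split; lra.
Unshelve. all: by end_near. Qed.

End singular_integral.

(** * The exchange for the heat kernel and the limit of the perimeter *)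

Section perimeter_limit.
Context {R : realType} {N : nat} (Q B : 'M[R]_N).
Variable E : set 'cV[R]_N.

Definition exchange (t : R) : \bar R :=
  (\int[lebesgue_cV]_X \int[lebesgue_cV]_Y
     (heat_kernel Q B X Y t * `|\1_E Y - \1_E X| `^ 1)%:E)%E.

Lemma exchange_ge0 t : (0 <= exchange t)%E.
Proof.
do 2![apply: integral_ge0 => ? _].
by rewrite lee_fin !mulr_ge0 ?divr_ge0 ?powR_ge0 ?expR_ge0 ?sqrtr_ge0.
Qed.

Lemma perimeterE s : perimeter Q B s E = singular_integral exchange s.
Proof.
rewrite /perimeter /besov_seminorm invr1 poweRe1; last first.
  apply: integral_ge0 => t _; rewrite mule_ge0 ?exchange_ge0 // lee_fin.
  by rewrite invr_ge0 powR_ge0.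
apply: eq_integral => t _; rewrite mulr1.
by have -> : 2 * s / 2 = s by rewrite mulrC mulKf.
Qed.

Hypothesis N0 : (0 < N)%N.
Hypothesis Qsym : Q^T = Q.
Hypothesis Qge0 : forall v : 'cV[R]_N, 0 <= dotv (Q *m v) v.
Hypothesis Kunit : forall t : R, 0 < t -> covmx Q B t \in unitmx.
Hypothesis trB : 0 <= \tr B.
Hypothesis mE : lebesgue_measurable E.

Lemma exchange_heat_bounds (t m : R) : 0 < t -> lebesgue_cV E = m%:E ->
  ((m + expR (- t * \tr B) * m - 2 * (heat_peak Q B t * m ^+ 2))%:E <= exchange t
     <= (m + expR (- t * \tr B) * m)%:E)%E.
Proof.
move=> t0 Em.
exact: (@completed_exchange_bounds _ _ _ (borel_lebesgue N)
  (fun z => heat_kernel Q B z.1 z.2 t) (heat_peak Q B t) (expR (- t * \tr B))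
  (measurable_heat_kernel Kunit t0) (fun z => heat_kernel_ge0 Kunit t0 z.1 z.2)
  (fun z => heat_kernel_le Qsym Qge0 Kunit t0 z.1 z.2)
  (integral_heat_kernel_r Qsym Qge0 Kunit t0)
  (integral_heat_kernel_l Qsym Qge0 Kunit t0) E m mE Em).
Qed.

Lemma heat_peak_small (e : R) : 0 < e ->
  exists T, forall t, T < t -> heat_peak Q B t <= e.
Proof.
move=> e0; pose a : R := (4 * pi) `^ (- (N%:R / 2)).
have a0 : 0 <= a by exact: powR_ge0.
have D0 := det_posdefmx_gt0 (posdefmx_tcovmx Qsym Qge0 Kunit ltr01).
set D := \det _ in D0.
(* From $\det C(t)\ge kD\ge(a/e)^2$ it follows that $a/\sqrt{\det C(t)}\le e$. *)
pose k := Num.bound ((a / e) ^+ 2 / D).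
exists k%:R => t kt; rewrite /heat_peak -/a.
have Dt := det_tcovmx_ge Qsym Qge0 Kunit N0 trB kt.
have kD : (a / e) ^+ 2 <= \det (tcovmx Q B t).
  apply: le_trans Dt; rewrite -/D -ler_pdivrMr //.
  by apply/ltW/archi_boundP; rewrite divr_ge0 ?sqr_ge0 // ltW.
have s0 : 0 < Num.sqrt (\det (tcovmx Q B t)).
  by rewrite sqrtr_gt0; apply: lt_le_trans Dt; rewrite mulr_gt0.
rewrite ler_pdivrMr // mulrC -ler_pdivrMr //.
by rewrite -[leLHS]ger0_norm ?divr_ge0 ?(ltW e0) // -sqrtr_sqr ler_sqrt // ltW // -sqrtr_gt0.
Qed.

Lemma exchange_limit (m : R) : 0 <= m -> lebesgue_cV E = m%:E ->
  forall e, 0 < e -> exists T, forall t, T < t ->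
    (((if \tr B == 0 then 2 * m else m) - e)%:E <= exchange t <=
     ((if \tr B == 0 then 2 * m else m) + e)%:E)%E.
Proof.
move=> m0 Em e e0.
(* A peak below this value makes $2m^2$ times it at most [e]; the added 1 covers $m=0$. *)
have d0 : 0 < e / (2 * m ^+ 2 + 1) by rewrite divr_gt0 // ltr_wpDl // mulr_ge0 ?exprn_ge0.
have [T1 HT1] := heat_peak_small d0.
have small t : T1 < t -> 2 * (heat_peak Q B t * m ^+ 2) <= e.
  move=> /HT1; rewrite ler_pdivlMr ?ltr_wpDl ?mulr_ge0 ?exprn_ge0 //.
  have := heat_peak_ge0 Q B t; have := exprn_ge0 2 m0; nra.
have [T2 HT2] : exists T2, forall t, T2 < t ->
    (if \tr B == 0 then 2 * m else m) <= m + expR (- t * \tr B) * m <=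
    (if \tr B == 0 then 2 * m else m) + e.
  have [tr0|tr0] := eqVneq (\tr B) 0.
    exists 0 => t _; rewrite tr0 mulr0 expR0; lra.
  have {}tr0 : 0 < \tr B by rewrite lt_def tr0.
  (* Since $e^{-x}\le1/(1+x)$ with $x=t\operatorname{tr}B$, the remainder $me^{-x}$ is below [e]
     once $xe>m$. *)
  exists (Num.max 0 (m / e / \tr B)) => t; rewrite gt_max => /andP[t0 tT].
  have r0 : 0 < expR (- t * \tr B) by exact: expR_gt0.
  have r1 : expR (- t * \tr B) * (1 + t * \tr B) <= 1.
    rewrite mulNr expRN mulrC ler_pdivrMr ?expR_gt0 // mul1r; exact: expR_ge1Dx.
  have mt : m < t * \tr B * e by rewrite -ltr_pdivrMr // -ltr_pdivrMr.
  by apply/andP; split; nra.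
exists (Num.max 0 (Num.max T1 T2)) => t; rewrite !gt_max => /and3P[t0 tT1 tT2].
have /andP[lo hi] := exchange_heat_bounds t0 Em.
have /andP[l2 h2] := HT2 t tT2; have l1 := small t tT1.
apply/andP; split.
- apply: le_trans lo; rewrite lee_fin; lra.
- by apply: le_trans hi _; rewrite lee_fin.
Qed.

End perimeter_limit.

Theorem mainTheorem2 (R : realType) (N : nat) (hN : (1 <= N)%N)
    (Q B : 'M[R]_N) (Qsym : Q^T = Q)
    (Qge0 : forall v : 'cV[R]_N, 0 <= dotv (Q *m v) v)
    (Kunit : forall t : R, 0 < t -> covmx Q B t \in unitmx)
    (trB : 0 <= \tr B)
    (E : set 'cV[R]_N) (mE : lebesgue_measurable E)
    (sigma : R) (sigma_gt0 : 0 < sigma) (sigma_lt : sigma < 2^-1)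
    (finE : finite_perimeter Q B sigma E) :
  (s%:E * perimeter Q B s E)%E @[s --> 0^'+] -->
    (if (\tr B == 0)%R then 2%:E * lebesgue_cV E else lebesgue_cV E)%E.
Proof.
have [LE] := finE; rewrite -/(perimeter Q B sigma E) perimeterE => Ioo.
(* Finite perimeter includes $\mathbf 1_E\in L^1$, whose norm is $|E|$; the hull and the exchange
   bounds rest on this finiteness. *)
have Efin : (lebesgue_cV E < +oo)%E.
  have /Lfun1_integrable/integrableP[_] := LE; congr (_ < _)%E.
  transitivity (\int[lebesgue_cV]_x (\1_E x)%:E)%E.
    by apply: eq_integral => x _; rewrite /= ger0_norm.
  by rewrite integral_indic // setIT.
pose m := fine (lebesgue_cV E).
have Em : lebesgue_cV E = m%:E by rewrite fineK // ge0_fin_numE // measure_ge0.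
have m0 : 0 <= m by rewrite fine_ge0 // measure_ge0.
have -> : (if (\tr B == 0)%R then 2%:E * lebesgue_cV E else lebesgue_cV E)%E =
    (if \tr B == 0 then 2 * m else m)%:E.
  by rewrite Em; case: ifP => //; rewrite EFinM.
under eq_fun do rewrite perimeterE.
apply: (@cvg_singular_integral _ (exchange Q B E) _ sigma) => //.
- by move=> t; exact: exchange_ge0.
- by case: ifP => _; rewrite ?mulr_ge0.
- exact: exchange_limit.
Qed.
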